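(* Let $(\epsilon_k)_{k\ge1}$ be any sequence of positive real numbers tending to zero. The following are equivalent: (a) the series $\sum_{k=1}^\infty\left(D_{\epsilon_{k+1}}f-D_{\epsilon_k}f\right)$ is unconditionally convergent in $H_2(\mathbb{T})$ for all $f\in H_2(\mathbb{T})$; (b) there is a finite constant $C$ such that $\displaystyle\sup_{\ell\in\mathbb{Z}}\sum_{k=1}^\infty\left|\widehat\varphi_{\epsilon_{k+1}}(\ell)-\widehat\varphi_{\epsilon_k}(\ell)\right|\le C$.
   Context: $H_2(\mathbb{T})$ is the Hardy space of functions $f(z)=\sum_{n=0}^\infty a_nz^n$ on the unit disc with $\sum_{n=0}^\infty|a_n|^2<\infty$; its norm is $\|f\|_{H_2}=\|f^*\|_{L^2(\mathbb{T})}$, where $f^*(e^{i\theta})=\sum_{n=0}^\infty a_ne^{in\theta}$ is the nontangential boundary function. For $\epsilon>0$ and $f\in H_2(\mathbb{T})$, $D_\epsilon f(z)=\frac1{2\epsilon}\int_{-\epsilon}^{\epsilon}f(ze^{-ix})\,dx$. Also $\widehat\varphi_\epsilon(\ell)=\frac{\sin(\ell\epsilon)}{\ell\epsilon}$ for $\ell\in\mathbb{Z}$ (equal to $1$ at $\ell=0$). A series $\sum_{k=1}^\infty f_k$ in a Banach space is unconditionally convergent if $\sum_{k=1}^\infty f_{\pi(k)}$ converges in norm for every permutation $\pi$ of $\{1,2,3,\dots\}$. *)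

(* Defs.v *)
From HB Require Import structures.
From mathcomp Require Import all_boot all_order all_algebra.
From mathcomp Require Import complex.
From mathcomp Require Import all_classical all_reals all_analysis.

Set Implicit Arguments.
Unset Strict Implicit.
Unset Printing Implicit Defensive.

Import Order.TTheory GRing.Theory Num.Theory.
Import numFieldNormedType.Exports.
Import ComplexField.Normc.

Local Open Scope classical_set_scope.
Local Open Scope ring_scope.
Local Open Scope complex_scope.

Section HardySpace.
Context {R : realType}.

(* The limits of complex sequences below are taken in [R[i]^o], whose topology
   is the one of the complex modulus. *)

Definition expi (t : R) : R[i] := cos t +i* sin t.

Lemma two_pi_gt0 : (0 : R) < 2 * pi.
Proof. by rewrite mulr_gt0 ?pi_gt0. Qed.

(* A function on the circle T is represented by a function of the angle t
   standing for the point e^{it}. T carries its normalized arc length, i.e.,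
   dt / 2 pi on [0, 2 pi]. *)
Definition circle_measure : probability (measurableTypeR R) R :=
  uniform_prob two_pi_gt0.

Definition L2norm (g : R -> R[i]) : \bar R :=
  Lnorm circle_measure 2%:E (fun t => (normc (g t))%:E).

Definition L2 (g : R -> R[i]) : Prop :=
  [/\ measurable_fun [set: R] (fun t => complex.Re (g t)),
      measurable_fun [set: R] (fun t => complex.Im (g t)) &
      (L2norm g < +oo)%E].

(* [f] is only looked at on the open unit disc. *)
Definition H2_coef (f : R[i] -> R[i]) (a : nat -> R[i]) : Prop :=
  cvgn (series (fun n => normc (a n) ^+ 2)) /\
  forall z : R[i], normc z < 1 ->
    series (fun n => a n * z ^+ n : R[i]^o) @ \oo --> (f z : R[i]^o).

Definition H2 (f : R[i] -> R[i]) : Prop := exists a, H2_coef f a.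

(* [g] is a version of f^*, i.e., f^*(e^{it}) = \sum_n a_n e^{int} as a series
   in L^2(T). *)
Definition is_boundary (f : R[i] -> R[i]) (g : R -> R[i]) : Prop :=
  exists a, [/\ H2_coef f a, L2 g &
    L2norm (fun t => \sum_(0 <= n < N) a n * expi (n%:R * t) - g t)
      @[N --> \oo] --> 0%E].

(* Determined up to a null set when [f] is in H_2. *)
Definition boundary (f : R[i] -> R[i]) : R -> R[i] :=
  xget (fun=> 0) [set g | is_boundary f g].

Definition H2norm (f : R[i] -> R[i]) : \bar R := L2norm (boundary f).

Definition H2_cvg_series (F : nat -> R[i] -> R[i]) : Prop :=
  (forall k, H2 (F k)) /\
  exists g, H2 g /\
    H2norm (fun z => \sum_(0 <= k < n) F k z - g z) @[n --> \oo] --> 0%E.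

Definition H2_unconditionally_cvg_series (F : nat -> R[i] -> R[i]) : Prop :=
  forall s : nat -> nat, bijective s -> H2_cvg_series (fun k => F (s k)).

Definition Dop (e : R) (f : R[i] -> R[i]) (z : R[i]) : R[i] :=
  ((2 * e)^-1)%:C *
  ((\int[lebesgue_measure]_(x in `[- e, e]) complex.Re (f (z * expi (- x))))
   +i*
   (\int[lebesgue_measure]_(x in `[- e, e]) complex.Im (f (z * expi (- x))))).

Definition phihat (e : R) (l : int) : R :=
  if l == 0 then 1 else sin (l%:~R * e) / (l%:~R * e).

End HardySpace.

(* Main.v *)
Require Import Defs.
From mathcomp Require Import all_boot all_order all_algebra.
From mathcomp Require Import complex.
From mathcomp Require Import all_classical all_reals all_analysis.
From mathcomp Require Import measurable_realfun.
From mathcomp Require Import ring lra.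
Set Implicit Arguments.
Unset Strict Implicit.
Unset Printing Implicit Defensive.
Import Order.TTheory GRing.Theory Num.Theory.
Import numFieldNormedType.Exports.
Import ComplexField.Normc.
Local Open Scope classical_set_scope.
Local Open Scope ring_scope.

(** On Fourier coefficients, D_e is the multiplication by phihat e, so the
  k-th term of the series multiplies the l-th coefficient a_l of f by
  d_k(l) = phihat (eps (k + 1)) l - phihat (eps k) l, a number at most 2 in
  absolute value. As phihat e is even, only l >= 0 matters, and as the norm of
  a function of H_2 is the l^2 norm of its coefficients, the theorem is one
  about the diagonal operators d_k on l^2.

  If sum_k |d_k(l)| <= C for all l, then for a permutation s the partial sums
  of the d_(s k)(l) converge to some T(l) with |T(l)| <= C. The function with
  coefficients a_l T(l) is the sum of the rearranged series: the square of the
  norm of the remainder is sum_l |a_l|^2 |sum_(k < n) d_(s k)(l) - T(l)|^2,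
  which tends to 0 by dominated convergence ([tannery],
  [H2_cvg_series_multiplier]).

  Conversely, suppose that the sums sum_k |d_k(l)| are not uniformly bounded.
  Since finitely many k contribute a bounded amount, beyond any index there
  are still a finite set A_j of indices k and an l_j with
  |sum_(k in A_j) d_k(l_j)| >= 2^j. Choose the A_j in successive blocks, a
  square summable sequence a with a_(l_j) >= 2^-j, and a permutation s that
  lists A_j at the start of the j-th block ([block_rearrangement]). The partial
  sums of the rearranged series at the two ends of A_j then differ by at least
  1 in their l_j-th coefficient, hence in norm, and the series diverges
  ([bounded_sums_of_uncond]).

  The norm of H_2 is defined through the boundary function, so reading it on
  the coefficients ([H2normE]) takes Parseval's identity for trigonometric
  polynomials and, for the existence of a boundary function, the Riesz-Fischer
  theorem: the partial sums along a fast subsequence converge almost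
  everywhere, and Fatou's lemma bounds the distance to their limit. That D_e
  is a multiplier ([H2_coef_Dop]) follows by integrating the power series term
  by term on a circle inside the disc. *)

(** * Rearrangements listing prescribed finite sets *)

Section Rearrangement.
Variables (m : nat -> nat) (A : nat -> pred nat).
Hypotheses (m0 : m 0%N = 0%N) (mS : forall i, (m i < m i.+1)%N).

Let block i := index_iota (m i) (m i.+1).

(** The blocks are the intervals [m i, m (i + 1)). The permutation is built
  through its initial segments: [listing j] writes out the first [j] blocks,
  each with its elements of [A i] in front. Since [listing j] is an initial
  segment of [listing k] for [j <= k], the entry at rank [i] may be read off
  any [listing j] that is long enough. *)
Fixpoint listing (j : nat) : seq nat :=
  if j is i.+1 then
    listing i ++ [seq k <- block i | A i k] ++ [seq k <- block i | ~~ A i k]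
  else [::].

Let m_homo : {homo m : i j / (i <= j)%N}.
Proof. by apply: homo_leq => //; [exact: leq_trans|move=> i; exact: ltnW]. Qed.

Let m_ge j : (j <= m j)%N.
Proof. by elim: j => // j /leq_ltn_trans; apply. Qed.

Lemma perm_listing j : perm_eq (listing j) (iota 0 (m j)).
Proof.
elim: j => [|j IH] /=; first by rewrite m0.
have -> : m j.+1 = (m j + (m j.+1 - m j))%N by rewrite subnKC// ltnW.
by rewrite iotaD add0n perm_cat// /block /index_iota perm_filterC.
Qed.

Lemma size_listing j : size (listing j) = m j.
Proof. by rewrite (perm_size (perm_listing j)) size_iota. Qed.

Lemma mem_listing j k : (k \in listing j) = (k < m j)%N.
Proof. by rewrite (perm_mem (perm_listing j)) mem_iota. Qed.

Lemma nth_listing j k i : (j <= k)%N -> (i < m j)%N ->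
  nth 0%N (listing k) i = nth 0%N (listing j) i.
Proof.
move=> jk ij; elim: k jk => [|k IH]; first by rewrite leqn0 => /eqP ->.
rewrite leq_eqVlt => /predU1P[->//|/[!ltnS] jk].
by rewrite -IH//= nth_cat size_listing (leq_trans ij (m_homo jk)).
Qed.

(** The rank [p] is where the elements of [A j] end in the [j]-th block, so that
  the partial sums of a rearranged series at [m j] and [p] differ by the sum
  over [A j] alone. *)
Lemma block_rearrangement :
  exists2 s : nat -> nat, bijective s &
  forall j, exists2 p, (m j <= p)%N & forall (V : nmodType) (c : nat -> V),
    \sum_(m j <= i < p) c (s i) = \sum_(m j <= k < m j.+1 | A j k) c k.
Proof.
pose s i := nth 0%N (listing i.+1) i.
have sE j i : (i < m j)%N -> s i = nth 0%N (listing j) i.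
  move=> ij; rewrite /s; have [ji|/ltnW ji] := leqP j i.+1.
    exact: nth_listing.
  by rewrite [RHS](nth_listing ji).
exists s.
  exists (fun k => index k (listing k.+1)) => i.
    set k := s i; pose J := maxn i.+1 k.+1.
    have iJ : (i < m J)%N by rewrite (leq_trans _ (m_ge _))// leq_maxl.
    have kk : k \in listing k.+1 by rewrite mem_listing.
    have idx : (index k (listing k.+1) < m k.+1)%N.
      by rewrite -size_listing index_mem.
    have /eqP : nth 0%N (listing J) (index k (listing k.+1)) =
                nth 0%N (listing J) i.
      by rewrite (@nth_listing k.+1) ?leq_maxr// nth_index// -(sE J).
    rewrite nth_uniq ?size_listing ?(perm_uniq (perm_listing _)) ?iota_uniq//.
      by move/eqP.
    by rewrite (leq_trans idx)// m_homo// leq_maxr.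
  have ii : i \in listing i.+1 by rewrite mem_listing.
  by rewrite (sE i.+1) ?nth_index// -size_listing index_mem.
move=> j; set B := [seq k <- block j | A j k].
exists (m j + size B)%N; first exact: leq_addr.
move=> V c; rewrite -[RHS]big_filter -/(block j) -/B.
rewrite -{1}[m j]add0n big_addn addKn [in RHS](big_nth 0%N) !big_mkord.
apply: eq_bigr => i _; rewrite (sE j.+1) /=.
  by rewrite nth_cat size_listing ltnNge leq_addl/= addnK nth_cat ltn_ord.
rewrite -(size_listing j.+1)/= !size_cat size_listing -/B.
by rewrite addnC ltn_add2l ltn_addr.
Qed.

End Rearrangement.

(** * Real series *)

Section RealSequences.
Variable R : realType.
Implicit Types (c u v : nat -> R) (s : nat -> nat).

(** Uniform bounds on partial sums of nonnegative terms survive rearrangement. *)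
Lemma le_sum_rearrangement c s n : injective s -> (forall k, 0 <= c k) ->
  exists N, \sum_(0 <= k < n) c (s k) <= \sum_(0 <= k < N) c k.
Proof.
move=> sI c0; pose N := (\max_(k < n) s k).+1; exists N.
have sN k : (k < n)%N -> (s k < N)%N.
  move=> kn; rewrite ltnS.
  exact: (leq_bigmax (F := fun k : 'I_n => s k) (Ordinal kn)).
rewrite -(big_map s xpredT c).
pose T := map s (index_iota 0 n).
rewrite (perm_big [seq k <- index_iota 0 N | k \in T]); last first.
  apply: uniq_perm; first by rewrite map_inj_uniq ?iota_uniq.
    by rewrite filter_uniq ?iota_uniq.
  move=> k; rewrite mem_filter -/T; case kT : (k \in T) => //=.
  by move/mapP: kT => [h]; rewrite !mem_index_iota/= => hN ->; rewrite sN.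
rewrite big_filter big_mkcond/= ler_sum// => k _.
by case: ifP.
Qed.

Lemma bounded_cvg_series u C : (forall n, 0 <= u n) ->
  (forall n, \sum_(0 <= k < n) u k <= C) -> cvgn (series u).
Proof.
move=> u0 uC; apply: nondecreasing_is_cvgn.
  by apply/nondecreasing_series => n _ _.
by exists C => _ [n _ <-]; exact: uC.
Qed.

Lemma ge0_series_le_lim u n : (forall n, 0 <= u n) -> cvgn (series u) ->
  series u n <= limn (series u).
Proof.
by move=> u0 cu; apply: nondecreasing_cvgn_le => //; apply: nondecreasing_series.
Qed.

Lemma sum_half_le2 n : \sum_(0 <= j < n) (2^-1 : R) ^+ j <= 2.
Proof.
suff -> : \sum_(0 <= j < n) (2^-1 : R) ^+ j = 2 - 2 * 2^-1 ^+ n.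
  by rewrite gerBl mulr_ge0 ?exprn_ge0 ?invr_ge0.
elim: n => [|n IH]; first by rewrite big_geq// expr0 mulr1 subrr.
by rewrite big_nat_recr//= IH exprS; field.
Qed.

(** The weight of an index [i] is the sum of the 2^-j over all [j] with [l j = i],
  which allows repetitions in [l]. The weights have total mass at most 2, and
  a summable sequence of numbers in [0, 2] is square summable. *)
Lemma ex_square_summable_weight (l : nat -> nat) :
  exists a : nat -> R, [/\ forall i, 0 <= a i,
    cvgn (series (fun i => a i ^+ 2)) & forall j, 2^-1 ^+ j <= a (l j)].
Proof.
pose w i j : R := 2^-1 ^+ j * (l j == i)%:R.
have w0 i j : 0 <= w i j by rewrite mulr_ge0 ?exprn_ge0 ?invr_ge0.
have wN i J : series (w i) J <= 2.
  apply: le_trans (sum_half_le2 J); apply: ler_sum => j _.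
  by rewrite /w; case: eqP; rewrite ?mulr1// mulr0 exprn_ge0 ?invr_ge0.
have cw i : cvgn (series (w i)) by apply: bounded_cvg_series (wN i).
pose a i := limn (series (w i)).
have a0 i : 0 <= a i by apply: limr_ge => //; near=> J; rewrite sumr_ge0.
have aN i : a i <= 2 by apply: limr_le => //; near=> J.
have sa L : \sum_(0 <= i < L) a i <= 2.
  have h : (\sum_(0 <= i < L) series (w i) J) @[J --> \oo] -->
           \sum_(0 <= i < L) a i.
    by apply: cvg_big => [|i _]; [exact: add_continuous|exact: cw].
  rewrite -(cvg_lim _ h)//; apply: limr_le; first by apply/cvg_ex; eexists; exact: h.
  near=> J; rewrite exchange_big/=; apply: le_trans (sum_half_le2 J).
  apply: ler_sum => j _; rewrite -mulr_sumr ler_piMr ?exprn_ge0 ?invr_ge0//.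
  have [lL|lL] := ltnP (l j) L.
    rewrite (bigD1_seq (l j)) ?mem_index_iota ?iota_uniq//= eqxx big1 ?addr0//.
    by move=> i /negbTE; rewrite eq_sym => ->.
  rewrite big_nat big1// => i /= iL; case: eqP => // li.
  by move: lL; rewrite li leqNgt iL.
exists a; split => //.
  apply: (@bounded_cvg_series _ (2 * 2)) => [i|L]; first exact: sqr_ge0.
  apply: (@le_trans _ _ (\sum_(0 <= i < L) 2 * a i)).
    by apply: ler_sum => i _; rewrite expr2 ler_wpM2r.
  by rewrite -mulr_sumr ler_wpM2l.
move=> j; apply: le_trans (ge0_series_le_lim j.+1 (w0 _) (cw _)).
rewrite /series/= big_nat_recr//= {2}/w eqxx mulr1 lerDr.
exact: sumr_ge0.
Unshelve. all: by end_near. Qed.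

(** Gliding hump: if the sums are unbounded in [l], then removing a finite
  number of indices [k] leaves them unbounded, because it costs at most [B] per
  index. Infinitely many disjoint humps therefore fit one behind the other, and
  a single weight [a] and a single permutation see all of them. *)
Lemma bounded_sums_of_uncond (d : nat -> nat -> R) (B : R) :
  (forall k l, `|d k l| <= B) ->
  (forall a : nat -> R, (forall l, 0 <= a l) -> cvgn (series (fun l => a l ^+ 2)) ->
    forall s, bijective s -> exists N, forall l n p, (N <= n <= p)%N ->
      `|a l * \sum_(n <= k < p) d (s k) l| < 1) ->
  exists C, forall l n, \sum_(0 <= k < n) `|d k l| <= C.
Proof.
move=> dB unc; apply: contrapT => /forallNP nC.
have hump (q j : nat) : exists x : nat * nat * pred nat, (q < x.1.2)%N /\
    2 ^+ j <= `|\sum_(q <= k < x.1.2 | x.2 k) d k x.1.1|.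
  have /existsNP[l /existsNP[n /negP]] := nC (q%:R * B + 2 * 2 ^+ j).
  rewrite -ltNge => big.
  (* [q.+1] keeps the new block nonempty. *)
  pose n' := maxn n q.+1.
  have qn' : (q < n')%N by rewrite leq_maxr.
  have : 2 * 2 ^+ j < \sum_(q <= k < n') `|d k l|.
    rewrite -(ltrD2l (\sum_(0 <= k < q) `|d k l|)) -big_cat_nat//=; last exact: ltnW.
    apply: (@le_lt_trans _ _ (q%:R * B + 2 * 2 ^+ j)).
      rewrite lerD2r; apply: (@le_trans _ _ (\sum_(0 <= k < q) B)).
        by apply: ler_sum => k _; exact: dB.
      by rewrite sumr_const_nat subn0 mulr_natl.
    apply: (lt_le_trans big); rewrite (big_cat_nat (n := n) (p := n'))//= ?leq_maxl//.
    by rewrite lerDl sumr_ge0.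
  (* The terms of one sign carry at least half of the sum of absolute values. *)
  pose P k := 0 <= d k l.
  have : \sum_(q <= k < n') `|d k l| <=
      `|\sum_(q <= k < n' | P k) d k l| + `|\sum_(q <= k < n' | ~~ P k) d k l|.
    rewrite (bigID P)/= lerD//.
      by rewrite (eq_bigr (fun k => d k l)) ?ler_norm// => k /ger0_norm.
    rewrite (eq_bigr (fun k => - d k l)); last first.
      by move=> k; rewrite -ltNge => /ltr0_norm.
    by rewrite sumrN -normrN ler_norm.
  have [h1|h1] := leP (2 ^+ j) `|\sum_(q <= k < n' | P k) d k l|.
    by move=> _ _; exists (l, n', P).
  have [h2 _ _|h2] := leP (2 ^+ j) `|\sum_(q <= k < n' | ~~ P k) d k l|.
    by exists (l, n', fun k => ~~ P k).
  by move=> h3 h4; lra.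
have [f fP] := choice (fun qj : nat * nat => hump qj.1 qj.2).
pose m := fix m j := if j is i.+1 then (f (m i, i)).1.2 else 0%N.
have mS j : (m j < m j.+1)%N by have [] := fP (m j, j).
pose l j := (f (m j, j)).1.1; pose A j := (f (m j, j)).2.
have [a [a0 a2 aw]] := ex_square_summable_weight l.
have [s bs sP] := block_rearrangement A (erefl : m 0%N = 0%N) mS.
have [N NP] := unc a a0 a2 s bs.
have mge j : (j <= m j)%N by elim: j => // j /leq_ltn_trans; apply.
have [p mp sumE] := sP N.
have := NP (l N) (m N) p; rewrite mge mp => /(_ isT).
rewrite (sumE _ (fun k => d k (l N))) ltNge => /negP; apply.
have [_ big] := fP (m N, N).
rewrite normrM (ger0_norm (a0 _)).
apply: (@le_trans _ _ (2^-1 ^+ N * 2 ^+ N)).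
  by rewrite -exprMn mulVf ?expr1n.
by apply: ler_pM => //; rewrite ?exprn_ge0 ?invr_ge0.
Qed.

(** Dominated convergence for series: the tail of [u] makes the terms beyond
  some [M] small uniformly in [n], and the first [M] terms form a finite sum. *)
Lemma tannery u (t : nat -> nat -> R) C :
  (forall l, 0 <= u l) -> cvgn (series u) ->
  (forall n l, 0 <= t n l <= C) -> (forall l, t ^~ l @ \oo --> 0) ->
  forall e, 0 < e -> \forall n \near \oo, forall L,
    \sum_(0 <= l < L) u l * t n l <= e.
Proof.
move=> u0 cu tC t0 e e0.
have C0 : 0 <= C by have /andP[a b] := tC 0%N 0%N; exact: le_trans b.
(* Not [e / 2 / C], as [C] may vanish. *)
pose d := e / 2 / (C + 1).
have d0 : 0 < d by rewrite divr_gt0 ?divr_gt0// ltr_wpDl.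
have [M _ MP] : \forall M \near \oo, `|limn (series u) - series u M| < d.
  by move/cvgrPdist_lt : (cu) => /(_ _ d0).
have head : (\sum_(0 <= l < M) u l * t n l) @[n --> \oo] --> (0 : R).
  rewrite [X in _ --> X](_ : _ = \sum_(0 <= l < M) (0 : R)); last by rewrite big1.
  apply: cvg_big => [|l _]; first exact: add_continuous.
  by rewrite -(mulr0 (u l)); apply: cvgMl_tmp; exact: t0.
have e20 : 0 < e / 2 by rewrite divr_gt0.
near=> n => L.
have hn : \sum_(0 <= l < M) u l * t n l <= e / 2.
  have : `|0 - \sum_(0 <= l < M) u l * t n l| < e / 2.
    by near: n; move/cvgrPdist_lt : head; apply.
  by rewrite sub0r normrN => h; rewrite ltW// (le_lt_trans (ler_norm _) h).
have ut0 l : 0 <= u l * t n l by rewrite mulr_ge0//; case/andP: (tC n l).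
have mono : \sum_(0 <= l < L) u l * t n l <= \sum_(0 <= l < maxn L M) u l * t n l.
  by rewrite (big_cat_nat (n := L) (p := maxn L M)) ?leq_maxl//= lerDl sumr_ge0.
apply: (le_trans mono).
rewrite (big_cat_nat (n := M)) ?leq_maxr//= [leRHS](splitr e) lerD//.
have tail : \sum_(M <= l < maxn L M) u l <= d.
  have -> : \sum_(M <= l < maxn L M) u l = series u (maxn L M) - series u M.
    by rewrite /series/= [in RHS](big_cat_nat (n := M)) ?leq_maxr//= addrAC subrr add0r.
  have := MP M (leqnn _); rewrite ger0_norm ?subr_ge0 ?ge0_series_le_lim//.
  move=> h; rewrite ltW// (le_lt_trans _ h)// lerD2r.
  exact: ge0_series_le_lim.
apply: (@le_trans _ _ (\sum_(M <= l < maxn L M) u l * C)).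
  by apply: ler_sum => l _; rewrite ler_wpM2l//; case/andP: (tC n l).
rewrite -mulr_suml (le_trans (ler_wpM2r C0 tail))//.
rewrite /d -[leLHS]mulrA ler_piMr ?(ltW e20)//.
by rewrite mulrC ler_pdivrMr ?ltr_wpDl// mul1r lerDl.
Unshelve. all: by end_near. Qed.

End RealSequences.

(** * Complex sequences and power series *)

Section ComplexSequences.
Variable R : realType.
Local Open Scope complex_scope.
Implicit Types (x y z : R[i]) (a b c : nat -> R[i]).

Lemma sqr_normcE x : normc x ^+ 2 = complex.Re x ^+ 2 + complex.Im x ^+ 2.
Proof. by case: x => u v /=; rewrite sqr_sqrtr// addr_ge0// sqr_ge0. Qed.

Lemma normc_ge0 x : 0 <= normc x.
Proof. by case: x => u v /=; exact: sqrtr_ge0. Qed.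

Lemma normcD x y : normc (x + y) <= normc x + normc y.
Proof. exact: le_normcD. Qed.

Lemma normc_opp x : normc (- x) = normc x.
Proof. exact: normcN. Qed.

Lemma normc_distC x y : normc (x - y) = normc (y - x).
Proof. by rewrite -normc_opp opprB. Qed.

Lemma normcB x y : normc (x - y) <= normc x + normc y.
Proof. by rewrite -(normc_opp y) normcD. Qed.

Lemma normcX x n : normc (x ^+ n) = normc x ^+ n.
Proof.
by elim: n => [|n IH]; rewrite ?expr0 ?normc1// !exprS normcM IH.
Qed.

Lemma normc_real (r : R) : normc r%:C = `|r|.
Proof. by rewrite /= expr0n addr0 sqrtr_sqr. Qed.

Lemma normc_Re x : `|complex.Re x| <= normc x.
Proof.
case: x => u v /=; rewrite -[leLHS]sqrtr_sqr ler_sqrt ?addr_ge0 ?sqr_ge0//.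
by rewrite lerDl sqr_ge0.
Qed.

Lemma normc_Im x : `|complex.Im x| <= normc x.
Proof.
case: x => u v /=; rewrite -[leLHS]sqrtr_sqr ler_sqrt ?addr_ge0 ?sqr_ge0//.
by rewrite lerDr sqr_ge0.
Qed.

Lemma normc_le_ReIm x : normc x <= `|complex.Re x| + `|complex.Im x|.
Proof.
rewrite -(@ler_pXn2r _ 2) ?nnegrE ?addr_ge0 ?normc_ge0// sqr_normcE sqrrD.
by rewrite !real_normK ?num_real// addrAC lerDl mulrn_wge0// mulr_ge0.
Qed.

Lemma ReD x y : complex.Re (x + y) = complex.Re x + complex.Re y.
Proof. by case: x; case: y. Qed.

Lemma ImD x y : complex.Im (x + y) = complex.Im x + complex.Im y.
Proof. by case: x; case: y. Qed.

Lemma ReB x y : complex.Re (x - y) = complex.Re x - complex.Re y.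
Proof. by case: x; case: y. Qed.

Lemma ImB x y : complex.Im (x - y) = complex.Im x - complex.Im y.
Proof. by case: x; case: y. Qed.

Lemma Re_sum I (r : seq I) P (F : I -> R[i]) :
  complex.Re (\sum_(i <- r | P i) F i) = \sum_(i <- r | P i) complex.Re (F i).
Proof. by apply: (big_morph _ ReD). Qed.

Lemma Im_sum I (r : seq I) P (F : I -> R[i]) :
  complex.Im (\sum_(i <- r | P i) F i) = \sum_(i <- r | P i) complex.Im (F i).
Proof. by apply: (big_morph _ ImD). Qed.

Lemma normc_sum I (r : seq I) P (F : I -> R[i]) :
  normc (\sum_(i <- r | P i) F i) <= \sum_(i <- r | P i) normc (F i).
Proof.
elim/big_rec2: _ => [|i u v _ uv]; first by rewrite normc0.
by rewrite (le_trans (normcD _ _))// lerD2l.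
Qed.

Lemma normr_normc (x : R[i]^o) : `|x| = (normc x)%:C.
Proof. by []. Qed.

Lemma cvgc_normP (u : nat -> R[i]) (l : R[i]) :
  (u n : R[i]^o) @[n --> \oo] --> (l : R[i]^o) <->
  normc (u n - l) @[n --> \oo] --> (0 : R).
Proof.
split=> [/cvgrPdist_lt h|/cvgrPdist_lt h]; apply/cvgrPdist_lt => e e0.
  have := h e%:C; rewrite ltcR => /(_ e0); apply: filterS => n.
  rewrite normr_normc ltcR normc_distC sub0r normrN ger0_norm//.
  exact: normc_ge0.
have [] : 0 < complex.Re e /\ e = (complex.Re e)%:C.
  by case: e e0 => e i; rewrite ltcE/= => /andP[/eqP -> ?].
move=> e1 ->; have := h _ e1; apply: filterS => n.
rewrite normr_normc ltcR normc_distC sub0r normrN ger0_norm//.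
exact: normc_ge0.
Qed.

Lemma cvgc_ReImP (u : nat -> R[i]) (l : R[i]) :
  (u n : R[i]^o) @[n --> \oo] --> (l : R[i]^o) <->
  complex.Re (u n) @[n --> \oo] --> complex.Re l /\
  complex.Im (u n) @[n --> \oo] --> complex.Im l.
Proof.
rewrite cvgc_normP; split => [/cvgrPdist_lt h|[hr hi]].
  by split; apply/cvgrPdist_lt => e /h; apply: filterS => n;
    rewrite sub0r normrN ger0_norm ?normc_ge0// normc_distC; apply: le_lt_trans;
    [rewrite -ReB normc_Re|rewrite -ImB normc_Im].
apply: (@squeeze_cvgr _ _ _ _ (fun=> 0)
  (fun n => `|complex.Re (u n) - complex.Re l| + `|complex.Im (u n) - complex.Im l|)).
- by near=> n; rewrite normc_ge0 -ReB -ImB normc_le_ReIm.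
- exact: cvg_cst.
- rewrite -[X in _ --> X]addr0; apply: cvgD; rewrite -[X in _ --> X](@normr0 _ R);
    apply: cvg_norm; [rewrite -(subrr (complex.Re l))|rewrite -(subrr (complex.Im l))];
    by apply: cvgB => //; exact: cvg_cst.
Unshelve. all: by end_near. Qed.

Definition square_summable a := cvgn (series (fun n => normc (a n) ^+ 2)).

Lemma sqr_normc_ge0 a n : 0 <= normc (a n) ^+ 2.
Proof. exact: sqr_ge0. Qed.

(** A bound on all coefficients is what compares the power series with a
  geometric series inside the disc. *)
Lemma square_summable_bounded a : square_summable a ->
  exists M, 0 <= M /\ forall n, normc (a n) <= M.
Proof.
move=> sa; pose S := limn (series (fun n => normc (a n) ^+ 2)).
have aS n : normc (a n) ^+ 2 <= S.
  apply: le_trans (ge0_series_le_lim n.+1 (sqr_normc_ge0 a) sa).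
  by rewrite /series/= big_nat_recr//= lerDr sumr_ge0// => *; exact: sqr_ge0.
exists (1 + S); split; first by rewrite addr_ge0// (le_trans _ (aS 0%N))// sqr_ge0.
move=> n; apply: (le_trans _ (lerD (lexx 1) (aS n))).
by have := sqr_ge0 (normc (a n) - 2^-1); nra.
Qed.

Lemma square_summableMr a (m : nat -> R) C : (forall n, `|m n| <= C) ->
  square_summable a -> square_summable (fun n => a n * (m n)%:C).
Proof.
move=> mC sa; apply: (@bounded_cvg_series _ _
  (C ^+ 2 * limn (series (fun n => normc (a n) ^+ 2)))) => [n|N].
  exact: sqr_ge0.
apply: le_trans (ler_wpM2l (sqr_ge0 C) (ge0_series_le_lim N (sqr_normc_ge0 a) sa)).
rewrite mulr_sumr ler_sum// => n _; rewrite normcM exprMn normc_real mulrC.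
by rewrite ler_wpM2r ?sqr_ge0// lerXn2r// nnegrE (le_trans _ (mC n)).
Qed.

Lemma square_summableD a b : square_summable a -> square_summable b ->
  square_summable (fun n => a n + b n).
Proof.
move=> sa sb; pose S c := limn (series (fun n => normc (c n) ^+ 2)).
apply: (@bounded_cvg_series _ _ (2 * S a + 2 * S b)) => [n|N].
  exact: sqr_ge0.
apply: (@le_trans _ _ (\sum_(0 <= k < N) (2 * normc (a k) ^+ 2 + 2 * normc (b k) ^+ 2))).
  apply: ler_sum => k _.
  apply: (@le_trans _ _ ((normc (a k) + normc (b k)) ^+ 2)).
    by rewrite lerXn2r ?nnegrE ?addr_ge0 ?normc_ge0 ?normcD.
  by have := sqr_ge0 (normc (a k) - normc (b k)); nra.
rewrite big_split/= -!mulr_sumr lerD// ler_wpM2l//.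
  exact: (ge0_series_le_lim N (sqr_normc_ge0 a)).
exact: (ge0_series_le_lim N (sqr_normc_ge0 b)).
Qed.

Lemma square_summableN a : square_summable a -> square_summable (fun n => - a n).
Proof.
by rewrite /square_summable; under [in X in _ -> X]eq_fun do rewrite normc_opp.
Qed.

Lemma power_series_bound M (r : R) : 0 <= M -> 0 <= r < 1 ->
  exists K, forall N, \sum_(0 <= n < N) M * r ^+ n <= K.
Proof.
move=> M0 /andP[r0 r1].
exists (limn (series (geometric M r))) => N.
apply: (@ge0_series_le_lim _ (geometric M r)) => [n|].
  by rewrite /= mulr_ge0 ?exprn_ge0.
by apply: is_cvg_geometric_series; rewrite ger0_norm.
Qed.

(** The real and imaginary parts of the power series converge absolutely,
  by comparison with a geometric series. *)
Lemma ex_H2_coef a : square_summable a -> exists f, H2_coef f a.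
Proof.
move=> sa; have [M [M0 aM]] := square_summable_bounded sa.
suff h z : exists w, normc z < 1 ->
    series (fun n => a n * z ^+ n : R[i]^o) @ \oo --> (w : R[i]^o).
  by have [f fP] := choice h; exists f.
have [z1|_] := ltP (normc z) 1; last by exists 0.
have [K KP] := power_series_bound M0 (introT andP (conj (normc_ge0 z) z1)).
have part (g : R[i] -> R) : (forall x, `|g x| <= normc x) ->
    cvgn (series (fun n => g (a n * z ^+ n))).
  move=> gn; apply: normed_cvg; apply: (@bounded_cvg_series _ _ K) => [n|N].
    exact: normr_ge0.
  apply: le_trans (KP N); apply: ler_sum => n _; rewrite (le_trans (gn _))//.
  by rewrite normcM normcX ler_wpM2r// exprn_ge0// normc_ge0.
exists (limn (series (fun n => complex.Re (a n * z ^+ n)))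
        +i* limn (series (fun n => complex.Im (a n * z ^+ n)))) => _.
apply/cvgc_ReImP; split => /=.
  apply: (cvg_trans _ (part _ normc_Re)); apply: near_eq_cvg.
  by near=> N; rewrite /series/= Re_sum.
apply: (cvg_trans _ (part _ normc_Im)); apply: near_eq_cvg.
by near=> N; rewrite /series/= Im_sum.
Unshelve. all: by end_near. Qed.

Lemma H2_coefD f g a b : H2_coef f a -> H2_coef g b ->
  H2_coef (fun z => f z + g z) (fun n => a n + b n).
Proof.
move=> [sa fa] [sb gb]; split; first exact: square_summableD.
move=> z z1; rewrite (_ : series _ = series (fun n => a n * z ^+ n : R[i]^o) \+
                                    series (fun n => b n * z ^+ n : R[i]^o)).
  by apply: cvgD; [exact: fa|exact: gb].
apply/funext => N; rewrite /series/= -big_split/=.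
by apply: eq_bigr => n _; rewrite mulrDl.
Qed.

Lemma H2_coefN f a : H2_coef f a -> H2_coef (fun z => - f z) (fun n => - a n).
Proof.
move=> [sa fa]; split; first exact: square_summableN.
move=> z z1; rewrite (_ : series _ = \- series (fun n => a n * z ^+ n : R[i]^o)).
  by apply: cvgN; exact: fa.
apply/funext => N; rewrite /series/= -sumrN.
by apply: eq_bigr => n _; rewrite mulNr.
Qed.

Lemma H2_coefB f g a b : H2_coef f a -> H2_coef g b ->
  H2_coef (fun z => f z - g z) (fun n => a n - b n).
Proof. by move=> fa /H2_coefN; exact: H2_coefD. Qed.

Lemma H2_coef0 : H2_coef (fun=> 0) (fun=> 0 : R[i]).
Proof.
split.
  rewrite (_ : series _ = cst 0); first exact: is_cvg_cst.
  by apply/funext => N; rewrite /series/= big1// => n _; rewrite expr0n addr0 sqrtr0 expr0n.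
move=> z _; rewrite (_ : series _ = cst 0); first exact: cvg_cst.
by apply/funext => N; rewrite /series/= big1// => n _; rewrite mul0r.
Qed.

Lemma H2_coef_sum (F : nat -> R[i] -> R[i]) (c : nat -> nat -> R[i]) N :
  (forall k, H2_coef (F k) (c k)) ->
  H2_coef (fun z => \sum_(0 <= k < N) F k z)
          (fun n => \sum_(0 <= k < N) c k n).
Proof.
move=> Fc; elim: N => [|N IH].
  under [X in H2_coef X _]funext do rewrite big_geq//.
  by under [X in H2_coef _ X]funext do rewrite big_geq//; exact: H2_coef0.
under [X in H2_coef X _]funext do rewrite big_nat_recr//=.
under [X in H2_coef _ X]funext do rewrite big_nat_recr//=.
exact: H2_coefD.
Qed.

(** If all coefficients before [c m] vanish, then evaluating at a small [r > 0]
  and dividing by [r ^+ m] bounds [c m] by the remaining terms, which are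
  [O(r)]. *)
Lemma H2_coef0_eq0 c : H2_coef (fun=> 0) c -> forall n, c n = 0.
Proof.
move=> [sc c0]; have [M [M0 cM]] := square_summable_bounded sc.
elim/ltn_ind => m IH; apply: eq0_normc; apply/eqP; rewrite eq_le normc_ge0 andbT.
have key (r : R) : 0 < r <= 2^-1 -> normc (c m) <= 2 * M * r.
  move=> /andP[r0 r2].
  have r1 : normc r%:C < 1 by rewrite normc_real gtr0_norm//; lra.
  rewrite -(ler_pM2r (exprn_gt0 m r0)).
  have -> : 2 * M * r * r ^+ m = 2 * M * r ^+ m.+1 by rewrite exprS mulrA.
  have /cvgc_normP h := c0 _ r1.
  (* The partial sums tend to 0; their norm is added to the bound on the tail,
     and the limit is taken at the end. *)
  have lim1 : 2 * M * r ^+ m.+1 +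
      normc (series (fun n => c n * r%:C ^+ n) N - 0) @[N --> \oo] -->
      2 * M * r ^+ m.+1 + 0.
    by apply: cvgD; [exact: cvg_cst|exact: h].
  rewrite addr0 in lim1; rewrite -(cvg_lim _ lim1)//.
  apply: limr_ge; first by apply/cvg_ex; eexists; exact: lim1.
  near=> N; have mN : (m < N)%N by near: N; exact: nbhs_infty_gt.
  rewrite subr0 /series/= (big_cat_nat (n := m))//= ?(ltnW mN)//.
  rewrite big_nat big1 => [|n /IH ->]; last by rewrite mul0r.
  rewrite add0r big_ltn//=.
  have tl : normc (\sum_(m.+1 <= n < N) c n * r%:C ^+ n) <= 2 * M * r ^+ m.+1.
    apply: (le_trans (normc_sum _ _ _)).
    rewrite -{1}[m.+1]add0n big_addn.
    apply: (@le_trans _ _ (\sum_(0 <= n < N - m.+1) M * r ^+ m.+1 * 2^-1 ^+ n)).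
      apply: ler_sum => n _; rewrite normcM normcX normc_real gtr0_norm//.
      rewrite -mulrA ler_pM ?normc_ge0 ?exprn_ge0 ?(ltW r0)//.
      rewrite addnC exprD ler_wpM2l ?exprn_ge0 ?(ltW r0)//.
      by rewrite lerXn2r// nnegrE ?invr_ge0 ?(ltW r0).
    rewrite -mulr_sumr -[leRHS]mulrA [leRHS]mulrC ler_wpM2l ?sum_half_le2//.
    by rewrite mulr_ge0 ?exprn_ge0 ?(ltW r0).
  set x := c m * _; set y := \sum_(_ <= _ < _) _ in tl *.
  have -> : normc (c m) * r ^+ m = normc x.
    by rewrite /x normcM normcX normc_real gtr0_norm.
  have := normcB (x + y) y; rewrite addrK => h1.
  by apply: (le_trans h1); rewrite [leLHS]addrC; exact: lerD.
apply/ler_addgt0Pl => e e0; rewrite addr0.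
pose r := Num.min 2^-1 (e / (2 * M + 1)).
have M1 : 0 < 2 * M + 1 by rewrite ltr_wpDl ?mulr_ge0.
have r0 : 0 < r <= 2^-1.
  by rewrite /r lt_min ge_min lexx invr_gt0 ltr0n divr_gt0.
apply: (le_trans (key r r0)).
have : r <= e / (2 * M + 1) by rewrite /r ge_min lexx orbT.
rewrite ler_pdivlMr// => h; apply: le_trans h.
by case/andP: r0 => r0 _; nra.
Unshelve. all: by end_near. Qed.

(** The coefficients chosen by [is_boundary] need not be those at hand;
  uniqueness identifies them. *)
Lemma H2_coef_uniq f a b : H2_coef f a -> H2_coef f b -> a = b.
Proof.
move=> fa fb; apply/funext => n; apply/eqP; rewrite -subr_eq0; apply/eqP.
have := H2_coefB fa fb; under [X in H2_coef X _]funext do rewrite subrr.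
by move/H2_coef0_eq0; exact.
Qed.

End ComplexSequences.

(** * Trigonometric integrals and Parseval's identity *)

Section TrigonometricIntegrals.
Variable R : realType.
Local Open Scope complex_scope.
Local Notation leb := (@lebesgue_measure R).
Implicit Types (c : R[i]) (a : nat -> R[i]).

Lemma normc_expi (t : R) : normc (expi t) = 1.
Proof. by rewrite /= cos2Dsin2 sqrtr1. Qed.

Lemma expiD (s t : R) : expi (s + t) = expi s * expi t.
Proof.
rewrite /expi cosD sinD; apply/eqP; rewrite eq_complex /= eqxx/=.
by rewrite addrC.
Qed.

Lemma expi0 : expi 0 = 1 :> R[i].
Proof. by rewrite /expi cos0 sin0. Qed.

Lemma expi_nat (t : R) n : expi (n%:R * t) = expi t ^+ n.
Proof.
elim: n => [|n IH]; first by rewrite mul0r expi0 expr0.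
by rewrite exprS -IH -expiD -natr1 mulrDl mul1r addrC.
Qed.

Lemma Re_mul_expi c (t : R) :
  complex.Re (c * expi t) = complex.Re c * cos t - complex.Im c * sin t.
Proof. by case: c. Qed.

Lemma Im_mul_expi c (t : R) :
  complex.Im (c * expi t) = complex.Re c * sin t + complex.Im c * cos t.
Proof. by case: c. Qed.

Lemma continuous_mul_cos (u v k : R) :
  continuous (fun x : R => u * cos (k * x) - v * sin (k * x)).
Proof.
have ck : continuous (fun x : R => k * x) by move=> x; exact: cvgMl_tmp.
move=> x; apply: cvgB; apply: cvgMl_tmp.
  by apply: (continuous_comp (ck x)); exact: continuous_cos.
by apply: (continuous_comp (ck x)); exact: continuous_sin.
Qed.

(** An antiderivative is explicit. The integrand is the real part of
  (u + i v) e^{ikx}; its imaginary part has the same form, with other [u] and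
  [v]. *)
Lemma Rintegral_trig (u v k p q : R) : k != 0 -> p < q ->
  \int[leb]_(x in `[p, q]) (u * cos (k * x) - v * sin (k * x)) =
  (u * sin (k * q) + v * cos (k * q)) / k - (u * sin (k * p) + v * cos (k * p)) / k.
Proof.
move=> k0 pq.
pose F (x : R) : R := (u * sin (k * x) + v * cos (k * x)) / k.
have dF (x : R) : is_derive x (1 : R) F (u * cos (k * x) - v * sin (k * x)).
  rewrite /F; apply: is_derive_eq.
  rewrite ?scaler0 ?addr0 ?add0r /GRing.scale /= !mulr1.
  by field.
rewrite /Rintegral.
have cF : continuous F.
  by move=> x; apply: differentiable_continuous; apply/derivable1_diffP; have [] := dF x.
rewrite (continuous_FTC2 (F := F) pq).
- by rewrite -EFinB.
- by apply: continuous_subspaceT; exact: continuous_mul_cos.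
- split => [x _|//|//]; first by have [] := dF x.
    exact/cvg_at_right_filter/cF.
  exact/cvg_at_left_filter/cF.
- by move=> x _; rewrite derive1E; have [] := dF x.
Qed.

Lemma continuous_integrable (f : R -> R) (p q : R) : continuous f ->
  leb.-integrable `[p, q] (EFin \o f).
Proof.
move=> cf; apply: continuous_compact_integrable; first exact: segment_compact.
exact: continuous_subspaceT.
Qed.

(** With [M = 0], the partial sums of the boundary series; general [M] gives
  their differences. *)
Definition trigpoly a M N (t : R) : R[i] :=
  \sum_(M <= n < N) a n * expi (n%:R * t).

Lemma continuous_sum (I : Type) (r : seq I) (F : I -> R -> R) :
  (forall i, continuous (F i)) -> continuous (fun x => \sum_(i <- r) F i x).
Proof.
move=> cF x; apply: cvg_big => [|i _]; first exact: add_continuous.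
exact: cF.
Qed.

Lemma continuous_Re_trigpoly a M N :
  continuous (fun t => complex.Re (trigpoly a M N t)).
Proof.
rewrite /trigpoly; under eq_fun do rewrite Re_sum.
apply: continuous_sum => n; under eq_fun do rewrite Re_mul_expi.
exact: continuous_mul_cos.
Qed.

Lemma continuous_Im_trigpoly a M N :
  continuous (fun t => complex.Im (trigpoly a M N t)).
Proof.
rewrite /trigpoly; under eq_fun do rewrite Im_sum.
apply: continuous_sum => n.
rewrite [X in continuous X](_ : _ = fun t : R => complex.Im (a n) * cos (n%:R * t) -
                                 - complex.Re (a n) * sin (n%:R * t)).
  exact: continuous_mul_cos.
by apply: funext => t; rewrite Im_mul_expi mulNr opprK addrC.
Qed.

Lemma continuous_sqr_trigpoly a M N :
  continuous (fun t => normc (trigpoly a M N t) ^+ 2).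
Proof.
rewrite [X in continuous X](_ : _ = fun t =>
    complex.Re (trigpoly a M N t) * complex.Re (trigpoly a M N t) +
    complex.Im (trigpoly a M N t) * complex.Im (trigpoly a M N t)).
  move=> x; apply: cvgD; apply: cvgM.
  - exact: continuous_Re_trigpoly.
  - exact: continuous_Re_trigpoly.
  - exact: continuous_Im_trigpoly.
  - exact: continuous_Im_trigpoly.
by apply/funext => t; rewrite sqr_normcE !expr2.
Qed.

(** The cross term of the square is what orthogonality annihilates. *)
Lemma sqr_normcD (x y : R[i]) :
  normc (x + y) ^+ 2 = normc x ^+ 2 + normc y ^+ 2 + 2 * complex.Re (x * y^*).
Proof. by rewrite !sqr_normcE; case: x => x1 x2; case: y => y1 y2 /=; ring. Qed.

Lemma cos_nat2pi n : cos (n%:R * (2 * pi)) = 1 :> R.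
Proof.
have := periodicn (@cosD2pi R) n 0; rewrite add0r cos0 => h; rewrite -[RHS]h.
by rewrite !mulr_natl.
Qed.

Lemma sin_nat2pi n : sin (n%:R * (2 * pi)) = 0 :> R.
Proof.
have := periodicn (@sinD2pi R) n 0; rewrite add0r sin0 => h; rewrite -[RHS]h.
by rewrite !mulr_natl.
Qed.

(** Each product of distinct exponentials has a nonzero integer frequency
  and so a vanishing integral over a period. *)
Lemma Rintegral_cross a M N :
  \int[leb]_(t in `[0, 2 * pi])
     complex.Re (trigpoly a M N t * (a N * expi (N%:R * t))^*) = 0.
Proof.
pose w n := a n * (a N)^*.
have E t : complex.Re (trigpoly a M N t * (a N * expi (N%:R * t))^*) =
  \sum_(M <= n < N) (complex.Re (w n) * cos ((N - n)%:R * t) -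
                     (- complex.Im (w n)) * sin ((N - n)%:R * t)).
  rewrite /trigpoly mulr_suml Re_sum big_nat [RHS]big_nat.
  apply: eq_bigr => n /andP[_ nN].
  rewrite natrB ?(ltnW nN)// mulrBl cosB sinB /w.
  by case: (a n) => x1 x2; case: (a N) => y1 y2 /=; ring.
under eq_Rintegral do rewrite E.
pose v n t := complex.Re (w n) * cos ((N - n)%:R * t) -
              (- complex.Im (w n)) * sin ((N - n)%:R * t).
have cv n : continuous (v n) by exact: continuous_mul_cos.
have h m : (m <= N)%N -> \int[leb]_(t in `[0, 2 * pi]) (\sum_(M <= n < m) v n t) = 0.
  elim: m => [_|m IH mN].
    under eq_Rintegral do rewrite big_geq//.
    by rewrite Rintegral_cst// mul0r.
  have [mM|Mm] := ltnP m M.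
    under eq_Rintegral do rewrite big_geq//.
    by rewrite Rintegral_cst// mul0r.
  under eq_Rintegral do rewrite big_nat_recr//=.
  rewrite RintegralD//.
  - rewrite IH ?(ltnW mN)// add0r Rintegral_trig ?pnatr_eq0 ?subn_eq0 -?ltnNge ?two_pi_gt0//.
    by rewrite mulr0 cos_nat2pi sin_nat2pi sin0 cos0 subrr.
  - by apply: continuous_integrable; exact: continuous_sum.
  - exact: continuous_integrable.
exact: h.
Qed.

(** Parseval's identity, by induction on [N]: the new term is orthogonal to the
  previous ones. *)
Lemma Rintegral_sqr_trigpoly a M N :
  \int[leb]_(t in `[0, 2 * pi]) (normc (trigpoly a M N t) ^+ 2) =
  2 * pi * \sum_(M <= n < N) normc (a n) ^+ 2.
Proof.
have mI : measurable (`[0, 2 * pi] : set (measurableTypeR R)) by exact: measurable_itv.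
elim: N => [|N IH].
  under eq_Rintegral do rewrite /trigpoly big_geq// [normc 0]normc0 expr0n.
  by rewrite Rintegral_cst// mul0r big_geq// mulr0.
have [NM|MN] := ltnP N M.
  under eq_Rintegral do rewrite /trigpoly big_geq// [normc 0]normc0 expr0n.
  by rewrite Rintegral_cst// mul0r big_geq// mulr0.
have E t : normc (trigpoly a M N.+1 t) ^+ 2 = normc (trigpoly a M N t) ^+ 2 +
    (normc (a N) ^+ 2 + 2 * complex.Re (trigpoly a M N t * (a N * expi (N%:R * t))^*)).
  rewrite /trigpoly big_nat_recr//= sqr_normcD [X in _ + X ^+ 2 + _]normcM.
  by rewrite [normc (expi _)]normc_expi mulr1 addrA.
have half : continuous (fun t =>
    complex.Re (trigpoly a M N t * (a N * expi (N%:R * t))^*)).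
  have -> : (fun t => complex.Re (trigpoly a M N t * (a N * expi (N%:R * t))^*)) =
     (fun t => (normc (trigpoly a M N.+1 t) ^+ 2 - normc (trigpoly a M N t) ^+ 2 -
       normc (a N) ^+ 2) / 2).
    by apply/funext => t; rewrite E; field.
  move=> x; apply: cvgM; last exact: cvg_cst.
  apply: cvgB; last exact: cvg_cst.
  by apply: cvgB; exact: continuous_sqr_trigpoly.
have cross : continuous (fun t =>
    2 * complex.Re (trigpoly a M N t * (a N * expi (N%:R * t))^*)).
  by move=> x; apply: cvgM; [exact: cvg_cst|exact: half].
under eq_Rintegral do rewrite E.
rewrite RintegralD//; last 2 first.
- by apply: continuous_integrable; exact: continuous_sqr_trigpoly.
- apply: continuous_integrable => x; apply: cvgD; [exact: cvg_cst|exact: cross].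
rewrite RintegralD//; last 2 first.
- by apply: continuous_integrable => x; exact: cvg_cst.
- exact: (continuous_integrable 0 (2 * pi) cross).
rewrite [X in _ + (_ + X)]RintegralZl//; last exact: (continuous_integrable 0 (2 * pi) half).
rewrite Rintegral_cross mulr0 addr0 Rintegral_cst// IH big_nat_recr// [RHS]mulrDr.
congr (_ + _); rewrite mulrC; congr (_ * _).
have := @two_pi_gt0 R; move: (2 * pi) => q q0.
by rewrite /= lebesgue_measure_itv/= lte_fin q0 -EFinB/= subr0.
Qed.

End TrigonometricIntegrals.

(** * The norm of L^2 of the circle *)

Section CircleNorm.
Variable R : realType.
Local Open Scope complex_scope.
Local Notation mu := (@circle_measure R).
Implicit Types (g h : R -> R[i]) (a : nat -> R[i]).

(** The component-wise measurability required by [L2]. *)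
Definition measurableC g :=
  measurable_fun [set: R] (fun t => complex.Re (g t)) /\
  measurable_fun [set: R] (fun t => complex.Im (g t)).

Lemma measurableCD g h : measurableC g -> measurableC h ->
  measurableC (fun t => g t + h t).
Proof.
move=> [gr gi] [hr hi]; split.
  by under eq_fun do rewrite ReD; exact: measurable_funD.
by under eq_fun do rewrite ImD; exact: measurable_funD.
Qed.

Lemma measurableCB g h : measurableC g -> measurableC h ->
  measurableC (fun t => g t - h t).
Proof.
move=> [gr gi] [hr hi]; split.
  by under eq_fun do rewrite ReB; exact: measurable_funB.
by under eq_fun do rewrite ImB; exact: measurable_funB.
Qed.

Lemma measurableC_trigpoly a M N : measurableC (trigpoly a M N).
Proof.
split; apply: continuous_measurable_fun.
  exact: continuous_Re_trigpoly.
exact: continuous_Im_trigpoly.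
Qed.

Lemma measurable_sqr_normc g : measurableC g ->
  measurable_fun [set: R] (fun t => normc (g t) ^+ 2).
Proof.
move=> [gr gi]; under eq_fun do rewrite sqr_normcE.
by apply: measurable_funD; exact: measurable_funX.
Qed.

Lemma measurable_normc g : measurableC g ->
  measurable_fun [set: R] (fun t => normc (g t)).
Proof.
move=> /measurable_sqr_normc mg.
rewrite (_ : (fun t => _) = Num.sqrt \o (fun t => normc (g t) ^+ 2)).
  apply: measurableT_comp mg.
  by apply: continuous_measurable_fun; exact: sqrt_continuous.
by apply/funext => t /=; rewrite sqrtr_sqr ger0_norm// normc_ge0.
Qed.

(** The square of the norm, kept as an integral, to which Parseval's identity
  and Fatou's lemma apply directly. *)
Definition energy g : \bar R := (\int[mu]_t (normc (g t) ^+ 2)%:E)%E.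

Lemma L2normE g : L2norm g = (energy g `^ 2^-1)%E.
Proof.
rewrite /L2norm unlock; congr (_ `^ _)%E; apply: eq_integral => t _.
by rewrite abse_EFin poweR_EFin powR_mulrn ?normr_ge0// ger0_norm// normc_ge0.
Qed.

Lemma L2norm_sqrt g (c : R) : 0 <= c -> energy g = c%:E ->
  L2norm g = (Num.sqrt c)%:E.
Proof. by move=> c0 gc; rewrite L2normE gc poweR_EFin powR12_sqrt. Qed.

Lemma energy_ge0 g : (0 <= energy g)%E.
Proof. by apply: integral_ge0 => t _; rewrite lee_fin sqr_ge0. Qed.

Lemma L2norm_le_sqrt g (c : R) : (energy g <= c%:E)%E ->
  (L2norm g <= (Num.sqrt c)%:E)%E.
Proof.
move=> gc; have := energy_ge0 g; case E : (energy g) gc => [r| |]//.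
rewrite !lee_fin => rc r0; rewrite (L2norm_sqrt r0 E) lee_fin.
exact: ler_wsqrtr.
Qed.

Lemma L2norm_ge0 g : (0 <= L2norm g)%E.
Proof. exact: Lnorm_ge0. Qed.

Lemma eq_L2norm g h : (forall t, normc (g t) = normc (h t)) -> L2norm g = L2norm h.
Proof. by move=> gh; congr Lnorm; apply/funext => t; rewrite gh. Qed.

(** Minkowski's inequality for the real functions |g| and |h|, after the pointwise
  triangle inequality. *)
Lemma L2normD g h : measurableC g -> measurableC h ->
  (L2norm (fun t => g t + h t)%R <= L2norm g + L2norm h)%E.
Proof.
move=> mg mh; have mn := measurable_normc.
apply: le_trans (minkowski_EFin mu (mn _ mg) (mn _ mh) _); last by rewrite ler1n.
have mle : (energy (fun t => g t + h t)%R <=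
    \int[mu]_t ((normc (g t) + normc (h t)) ^+ 2)%:E)%E.
  apply: ge0_le_integral => //.
  - by move=> t _; rewrite lee_fin sqr_ge0.
  - apply/measurable_EFinP.
    exact: (measurable_sqr_normc (measurableCD mg mh)).
  - apply/measurable_EFinP; apply: measurable_funX; apply: measurable_funD; exact: mn.
  - by move=> t _; rewrite lee_fin lerXn2r ?nnegrE ?addr_ge0 ?normc_ge0 ?normcD.
rewrite L2normE unlock.
apply: gt0_ler_poweR => //.
- by rewrite in_itv/= energy_ge0 leey.
- by rewrite in_itv/= leey andbT integral_ge0// => t _; exact: poweR_ge0.
apply: le_trans mle _; rewrite le_eqVlt; apply/orP; left; apply/eqP.
apply: eq_integral => t _.
rewrite [(EFin \o _) t]/comp abse_EFin poweR_EFin powR_mulrn ?normr_ge0//.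
by rewrite ger0_norm// addr_ge0// normc_ge0.
Qed.

Lemma energy_trigpoly a M N :
  energy (trigpoly a M N) = (\sum_(M <= n < N) normc (a n) ^+ 2)%:E.
Proof.
rewrite /energy /circle_measure integral_uniform.
- rewrite subr0 -[X in (_ * X)%E]fineK.
    rewrite [X in (_ * X%:E)%E](Rintegral_sqr_trigpoly a M N) -EFinM.
    by rewrite mulKf// gt_eqF// two_pi_gt0.
  by apply: integrable_fin_num => //; apply: continuous_integrable;
    exact: continuous_sqr_trigpoly.
- apply/measurable_EFinP.
  exact: (measurable_sqr_normc (measurableC_trigpoly a M N)).
- by move=> t; rewrite lee_fin sqr_ge0.
Qed.

Lemma L2norm_trigpoly a M N :
  L2norm (trigpoly a M N) = (Num.sqrt (\sum_(M <= n < N) normc (a n) ^+ 2))%:E.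
Proof.
by apply: L2norm_sqrt (energy_trigpoly _ _ _); rewrite sumr_ge0// => n _; exact: sqr_ge0.
Qed.

End CircleNorm.

(** * The Riesz-Fischer theorem *)

Section RieszFischer.
Variable R : realType.
Local Open Scope complex_scope.
Local Notation mu := (@circle_measure R).
Implicit Types (g h : R -> R[i]) (a : nat -> R[i]).

Definition sqr_sum a := limn (series (fun n => normc (a n) ^+ 2)).

Definition sqr_tail a N := sqr_sum a - \sum_(0 <= n < N) normc (a n) ^+ 2.

Lemma sqr_tail_cvg0 a : square_summable a -> sqr_tail a N @[N --> \oo] --> (0 : R).
Proof.
move=> sa; rewrite -(subrr (sqr_sum a)).
by apply: cvgB; [exact: cvg_cst|exact: sa].
Qed.

Lemma sum_le_sqr_tail a M N : square_summable a -> (M <= N)%N ->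
  \sum_(M <= n < N) normc (a n) ^+ 2 <= sqr_tail a M.
Proof.
move=> sa MN; rewrite /sqr_tail lerBrDl -big_cat_nat//.
exact: (ge0_series_le_lim N (sqr_normc_ge0 a) sa).
Qed.

Lemma sqr_tail_ge0 a M : square_summable a -> 0 <= sqr_tail a M.
Proof. by move=> sa; have := sum_le_sqr_tail sa (leqnn M); rewrite big_geq. Qed.

(** Along such a subsequence, consecutive partial sums are within 2^-j of each
  other in L^2, which makes the sum of their distances finite. *)
Lemma ex_fast_tail a : square_summable a -> exists v : nat -> nat,
  (forall j, (v j < v j.+1)%N) /\ forall j, sqr_tail a (v j) <= 4^-1 ^+ j.
Proof.
move=> sa; have /cvgrPdist_le t0 := sqr_tail_cvg0 sa.
have next (mj : nat * nat) :
    exists n, (mj.1 < n)%N /\ sqr_tail a n <= 4^-1 ^+ mj.2.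
  have e0 : 0 < (4^-1 : R) ^+ mj.2 by rewrite exprn_gt0// invr_gt0.
  have [K _ KP] := t0 _ e0; exists (maxn K mj.1.+1); rewrite leq_maxr; split => //.
  have := KP (maxn K mj.1.+1) (leq_maxl _ _).
  by rewrite sub0r normrN; apply: le_trans; exact: ler_norm.
have [f fP] := choice next.
pose v := fix v j := if j is i.+1 then f (v i, i.+1) else f (0%N, 0%N).
exists v; split => [j|[|j]].
- by have [] := fP (v j, j.+1).
- by have [] := fP (0%N, 0%N).
- by have [] := fP (v j, j.+1).
Qed.

(** On a probability space the L^1 norm is at most the L^2 norm. Here this comes
  from x <= c / 2 + x^2 / (2 c), which is sharp at x = c. *)
Lemma energy_le_integral_normc g (c : R) : measurableC g -> 0 < c ->
  (energy g <= (c ^+ 2)%:E)%E -> (\int[mu]_t (normc (g t))%:E <= c%:E)%E.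
Proof.
move=> mg c0 gc.
have m2 : measurable_fun [set: measurableTypeR R] (fun t => (normc (g t) ^+ 2)%:E).
  by apply/measurable_EFinP; exact: (measurable_sqr_normc mg).
apply: (@le_trans _ _ (\int[mu]_t ((c / 2)%:E + ((2 * c)^-1)%:E * (normc (g t) ^+ 2)%:E))%E).
  apply: ge0_le_integral => //.
  - by move=> t _; rewrite lee_fin normc_ge0.
  - by apply/measurable_EFinP; exact: (measurable_normc mg).
  - apply: emeasurable_funD; first exact: measurable_cst.
    exact: measurable_funeM.
  - move=> t _; rewrite -EFinM -EFinD lee_fin.
    have -> : c / 2 + (2 * c)^-1 * normc (g t) ^+ 2 =
       normc (g t) + (normc (g t) - c) ^+ 2 / (2 * c).
      by field; rewrite gt_eqF.
    by rewrite lerDl divr_ge0 ?sqr_ge0// mulr_ge0// ltW.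
rewrite ge0_integralD//=.
- rewrite integral_cst//= [X in (_ * X)%E]probability_setT mule1.
  rewrite ge0_integralZl//=.
  + apply: (@le_trans _ _ ((c / 2)%:E + ((2 * c)^-1)%:E * (c ^+ 2)%:E)%E).
      by rewrite leeD2l// lee_wpmul2l// lee_fin invr_ge0 mulr_ge0// ltW.
    rewrite -EFinM -EFinD lee_fin.
    have -> : (2 * c)^-1 * c ^+ 2 = c / 2 by field; rewrite gt_eqF.
    by rewrite -splitr.
  + by move=> t _; rewrite lee_fin sqr_ge0.
  + by rewrite lee_fin invr_ge0 mulr_ge0// ltW.
- by move=> t _; rewrite lee_fin divr_ge0// ltW.
- by move=> t _; rewrite -EFinM lee_fin mulr_ge0 ?sqr_ge0// invr_ge0 mulr_ge0// ltW.
- exact: measurable_funeM.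
Qed.

Lemma limn_einf_le (u : (\bar R)^nat) (C : \bar R) :
  (forall n, u n <= C)%E -> (limn_einf u <= C)%E.
Proof.
move=> uC; rewrite limn_einf_lim; apply: lime_le; first exact: is_cvg_einfs.
near=> n; apply: le_trans (uC n); apply: ereal_inf_lbound.
by exists n => //=.
Unshelve. all: by end_near. Qed.

Lemma measurable_limn_einf (u : nat -> R -> \bar R) :
  (forall n, measurable_fun [set: measurableTypeR R] (u n)) ->
  measurable_fun [set: measurableTypeR R] (fun t => limn_einf (u^~ t)).
Proof.
move=> mu_; rewrite /limn_einf; apply: measurableT_comp => //.
apply: measurable_fun_limn_esup => n.
exact: measurableT_comp.
Qed.

Lemma trigpoly_cat a M N t : (M <= N)%N ->
  trigpoly a 0 N t = trigpoly a 0 M t + trigpoly a M N t.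
Proof. by move=> MN; rewrite /trigpoly -big_cat_nat. Qed.

(** The sum over [j] of |S_(v (j + 1)) - S_(v j)|, where S_N is the N-th partial
  sum, has integral at most 2, so it is finite almost everywhere, and there the
  partial sums converge absolutely. *)
Lemma ae_cvg_trigpoly a (v : nat -> nat) : square_summable a ->
  (forall j, (v j < v j.+1)%N) -> (forall j, sqr_tail a (v j) <= 4^-1 ^+ j) ->
  {ae mu, forall t, cvgn (fun j => complex.Re (trigpoly a 0 (v j) t)) /\
                    cvgn (fun j => complex.Im (trigpoly a 0 (v j) t))}.
Proof.
move=> sa vS vt.
pose u j t := trigpoly a (v j) (v j.+1) t.
have mu_ j : measurable_fun [set: measurableTypeR R] (fun t => (normc (u j t))%:E).
  by apply/measurable_EFinP; exact: (measurable_normc (measurableC_trigpoly _ _ _)).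
have u0 j t : (0 <= (normc (u j t))%:E)%E by rewrite lee_fin normc_ge0.
have uint j : (\int[mu]_t (normc (u j t))%:E <= (2^-1 ^+ j)%:E)%E.
  apply: energy_le_integral_normc.
  - exact: measurableC_trigpoly.
  - by rewrite exprn_gt0 ?invr_gt0.
  - rewrite energy_trigpoly lee_fin.
    apply: (le_trans (sum_le_sqr_tail sa (ltnW (vS j)))).
    apply: (le_trans (vt j)); rewrite -exprM mulnC exprM.
    by rewrite (_ : 2^-1 ^+ 2 = 4^-1 :> R)//; field.
pose G t : \bar R := (\sum_(0 <= j <oo) (normc (u j t))%:E)%E.
have Gint : (\int[mu]_t G t <= 2%:E)%E.
  rewrite integral_nneseries//; apply: lime_le.
    by apply: is_cvg_nneseries => j _ _; exact: integral_ge0.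
  near=> n; apply: (@le_trans _ _ (\sum_(0 <= j < n) (2^-1 ^+ j)%:E)%E).
    by apply: lee_sum => j _; exact: uint.
  by rewrite sumEFin lee_fin sum_half_le2.
have mG : measurable_fun [set: measurableTypeR R] G.
  by apply: ge0_emeasurable_sum.
have iG : mu.-integrable [set: measurableTypeR R] G.
  apply/integrableP; split => //.
  apply: le_lt_trans (ltry 2); apply: le_trans Gint.
  rewrite le_eqVlt; apply/orP; left; apply/eqP; apply: eq_integral => t _.
  by rewrite gee0_abs// nneseries_ge0.
have := integrable_ae measurableT iG; apply: filterS => t /(_ I) Gt.
have cn : cvgn (series (fun j => normc (u j t))).
  by apply: nnseries_is_cvg => [j|]; [exact: normc_ge0|rewrite ltey_eq Gt].
have part (p : R[i] -> R) : {morph p : x y / x + y} -> (forall x, `|p x| <= normc x) ->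
    cvgn (fun j => p (trigpoly a 0 (v j) t)).
  move=> pD pn.
  have cp : cvgn (series (fun j => p (u j t))).
    apply: normed_cvg; apply: (series_le_cvg _ _ _ cn) => j;
      [exact: normr_ge0|exact: normc_ge0|exact: pn].
  rewrite (_ : (fun j => _) =
      (fun j => p (trigpoly a 0 (v 0%N) t) + series (fun j => p (u j t)) j)).
    by apply: is_cvgD => //; exact: is_cvg_cst.
  apply/funext; elim => [|j IH].
    by rewrite /series/= big_geq// addr0.
  rewrite (trigpoly_cat _ _ (ltnW (vS j))) pD IH.
  by rewrite /series/= big_nat_recr//= addrA.
by split; apply: part; [exact: ReD|exact: normc_Re|exact: ImD|exact: normc_Im].
Unshelve. all: by end_near. Qed.

Lemma cvg_sqr_normc (u : nat -> R[i]) (l : R[i]) :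
  (u n : R[i]^o) @[n --> \oo] --> (l : R[i]^o) ->
  normc (u n) ^+ 2 @[n --> \oo] --> normc l ^+ 2.
Proof.
move=> /cvgc_ReImP[ur ui]; rewrite sqr_normcE !expr2.
rewrite (_ : (fun n => _) = (fun n => complex.Re (u n) * complex.Re (u n) +
                                      complex.Im (u n) * complex.Im (u n))).
  by apply: cvgD; apply: cvgM.
by apply/funext => n; rewrite sqr_normcE !expr2.
Qed.

(** The upper limit is measurable in a parameter even at points where the
  sequence diverges, hence its use in place of the limit. *)
Lemma cvg_fine_limn_esup (w : R ^nat) : cvgn w ->
  w @ \oo --> fine (limn_esup (EFin \o w)).
Proof.
move=> cw; have /cvg_limn_einf_sup[_ ->] : (EFin \o w) @ \oo --> (limn w)%:E.
  by apply: cvg_EFin => //; exact: nearW.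
exact: cw.
Qed.

(** Fatou's lemma along the subsequence bounds the distance from S_N to the
  almost everywhere limit by that from S_N to the later partial sums. *)
Lemma riesz_fischer a : square_summable a ->
  exists g, measurableC g /\ forall N,
    (energy (fun t => trigpoly a 0 N t - g t)%R <= (sqr_tail a N)%:E)%E.
Proof.
move=> sa; have [v [vS vt]] := ex_fast_tail sa.
have v_ge j : (j <= v j)%N by elim: j => // j /leq_ltn_trans; apply.
pose gr t := fine (limn_esup (fun j => (complex.Re (trigpoly a 0 (v j) t))%:E)).
pose gi t := fine (limn_esup (fun j => (complex.Im (trigpoly a 0 (v j) t))%:E)).
pose g t := gr t +i* gi t.
have mT N := measurableC_trigpoly a 0 N.
have mg : measurableC g.
  split; rewrite /=.
    apply: (measurableT_comp (fine_measurable measurableT)).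
    by apply: measurable_fun_limn_esup => j; apply/measurable_EFinP; case: (mT (v j)).
  apply: (measurableT_comp (fine_measurable measurableT)).
  by apply: measurable_fun_limn_esup => j; apply/measurable_EFinP; case: (mT (v j)).
exists g; split => // N.
(* The shift by [N] ensures [N <= v (j + N)] for all [j]. *)
pose F j t : \bar R := (normc (trigpoly a 0 N t - trigpoly a 0 (v (j + N)%N) t) ^+ 2)%:E.
have mF j : measurable_fun [set: measurableTypeR R] (F j).
  by apply/measurable_EFinP; exact: (measurable_sqr_normc (measurableCB (mT _) (mT _))).
have F0 j t : (0 <= F j t)%E by rewrite lee_fin sqr_ge0.
have EF j : (\int[mu]_t F j t <= (sqr_tail a N)%:E)%E.
  have Nv : (N <= v (j + N))%N by rewrite (leq_trans _ (v_ge _))// leq_addl.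
  rewrite [leLHS](_ : _ = energy (trigpoly a N (v (j + N)%N))).
    by rewrite energy_trigpoly lee_fin sum_le_sqr_tail.
  apply: eq_integral => t _; rewrite /F (trigpoly_cat _ _ Nv) opprD addrA subrr.
  by rewrite sub0r normc_opp.
have aeF : {ae mu, forall t, [set: measurableTypeR R] t ->
    (normc (trigpoly a 0 N t - g t) ^+ 2)%:E = limn_einf (F ^~ t)}.
  have := ae_cvg_trigpoly sa vS vt.
  apply: (@filterS _ _ (ae_filter_ringOfSetsType mu)) => t [cr ci] _.
  have gE : (trigpoly a 0 (v j) t : R[i]^o) @[j --> \oo] --> (g t : R[i]^o).
    by apply/cvgc_ReImP; split; exact: cvg_fine_limn_esup.
  have dE : (trigpoly a 0 N t - trigpoly a 0 (v (j + N)%N) t : R[i]^o) @[j --> \oo]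
      --> (trigpoly a 0 N t - g t : R[i]^o).
    apply: cvgB; first exact: cvg_cst.
    by rewrite (cvg_shiftn N (fun j => trigpoly a 0 (v j) t : R[i]^o)).
  suff /cvg_limn_einf_sup[-> _] : F ^~ t @ \oo -->
      (normc (trigpoly a 0 N t - g t) ^+ 2)%:E by [].
  by apply: cvg_EFin; [exact: nearW|exact: cvg_sqr_normc dE].
have -> : energy (fun t => trigpoly a 0 N t - g t) = (\int[mu]_t limn_einf (F ^~ t))%E.
  apply: ae_eq_integral => //.
  - by apply/measurable_EFinP; exact: (measurable_sqr_normc (measurableCB (mT _) mg)).
  - exact: measurable_limn_einf.
apply: le_trans (fatou mu measurableT mF (fun j t _ => F0 j t)) _.
exact: limn_einf_le.
Qed.

End RieszFischer.

(** * The norm of H_2 on coefficients *)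

Section BoundaryNorm.
Variable R : realType.
Local Open Scope complex_scope.
Implicit Types (f : R[i] -> R[i]) (g h : R -> R[i]) (a : nat -> R[i]).

Lemma cvg_sqrt (u : R ^nat) (l : R) : u @ \oo --> l ->
  Num.sqrt (u N) @[N --> \oo] --> Num.sqrt l.
Proof. by move=> ul; exact: (cvg_comp _ _ ul (@sqrt_continuous R l)). Qed.

Lemma cvg_sqrt_tail a : square_summable a ->
  ((Num.sqrt (sqr_tail a N))%:E @[N --> \oo] --> 0%E).
Proof.
move=> sa; apply: cvg_EFin; first exact: nearW.
by rewrite -[X in _ --> X]sqrtr0; exact: (cvg_sqrt (sqr_tail_cvg0 sa)).
Qed.

(** The distance to the limit provided by the Riesz-Fischer theorem is at most
  the square root of a tail of the series of squares. *)
Lemma ex_boundary f a : H2_coef f a -> exists g, is_boundary f g.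
Proof.
move=> fa; have sa : square_summable a by case: fa.
have [g [mg ge]] := riesz_fischer sa.
have nle N := L2norm_le_sqrt (ge N).
exists g, a; split => //.
  split; [by case: mg|by case: mg|].
  rewrite (@eq_L2norm _ _ (fun t => trigpoly a 0 0 t - g t)).
    exact: le_lt_trans (nle 0%N) (ltry _).
  by move=> t; rewrite /trigpoly big_geq// sub0r normc_opp.
apply: (@squeeze_cvge _ _ _ _ (fun=> 0%E) _ (fun N => (Num.sqrt (sqr_tail a N))%:E)).
- by near=> N; rewrite nle andbT L2norm_ge0.
- exact: cvg_cst.
- exact: cvg_sqrt_tail.
Unshelve. all: by end_near. Qed.

(** The norm of the boundary function is the limit of the norms of the partial
  sums, which Parseval's identity computes; the triangle inequality is used in
  both directions. *)
Lemma H2normE f a : H2_coef f a -> H2norm f = (Num.sqrt (sqr_sum a))%:E.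
Proof.
move=> fa; rewrite /H2norm.
have : is_boundary f (boundary f).
  (* The default value of [xget] is ruled out by existence. *)
  by have [g gP] := ex_boundary fa; exact: (xgetI _ gP).
move: (boundary f) => g [a' [fa' [gr gi goo] d0]].
move: d0; rewrite (H2_coef_uniq fa' fa) => d0.
have [sa _] := fa.
have mg : measurableC g by [].
pose S N := trigpoly a 0 N.
have mS N : measurableC (S N) by exact: measurableC_trigpoly.
have mD N := measurableCB (mS N) mg.
have gfin : L2norm g \is a fin_num by rewrite ge0_fin_numE// L2norm_ge0.
have q0 : L2norm (S N) @[N --> \oo] --> (Num.sqrt (sqr_sum a))%:E.
  under eq_fun do rewrite L2norm_trigpoly.
  apply: cvg_EFin; first exact: nearW.
  exact: (cvg_sqrt sa).
have upper : (L2norm g <= (Num.sqrt (sqr_sum a))%:E)%E.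
  have h : (L2norm (S N) + L2norm (fun t => S N t - g t)%R)%E @[N --> \oo] -->
           ((Num.sqrt (sqr_sum a))%:E + 0)%E by exact: cvgeD.
  rewrite adde0 in h; rewrite -(cvg_lim _ h)//; apply: lime_ge.
    by apply/cvg_ex; eexists; exact: h.
  near=> N; rewrite -[X in (_ <= _ + X)%E](@eq_L2norm _ (fun t => g t - S N t)); last first.
    by move=> t; exact: normc_distC.
  rewrite (@eq_L2norm _ g (fun t => S N t + (g t - S N t))).
    exact: L2normD (measurableCB mg (mS N)).
  by move=> t; rewrite addrC subrK.
have lower : ((Num.sqrt (sqr_sum a))%:E <= L2norm g)%E.
  have h : (L2norm g + L2norm (fun t => S N t - g t)%R)%E @[N --> \oo] -->
           (L2norm g + 0)%E by apply: cvgeD => //; [exact: fin_num_adde_defr|exact: cvg_cst].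
  rewrite adde0 in h; rewrite -(cvg_lim _ h)// -(cvg_lim _ q0)//; apply: lee_lim.
  - by apply/cvg_ex; eexists; exact: q0.
  - by apply/cvg_ex; eexists; exact: h.
  near=> N; rewrite (@eq_L2norm _ (S N) (fun t => g t + (S N t - g t))).
    exact: L2normD.
  by move=> t; rewrite addrC subrK.
by apply/eqP; rewrite eq_le upper lower.
Unshelve. all: by end_near. Qed.

End BoundaryNorm.

(** * The averages D_e as Fourier multipliers *)

Section Averages.
Variable R : realType.
Local Open Scope complex_scope.
Local Notation leb := (@lebesgue_measure R).
Implicit Types (f : R[i] -> R[i]) (a : nat -> R[i]) (e : R).

(** Mean value theorem, as the derivative of sin is bounded by 1. *)
Lemma normr_sin_le (x : R) : `|sin x| <= `|x|.
Proof.
wlog x0 : x / 0 < x.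
  move=> h; have [/h//|] := ltP 0 x.
  rewrite le_eqVlt => /predU1P[->|x0]; first by rewrite sin0.
  by rewrite -normrN -[leRHS]normrN -sinN h// oppr_gt0.
have [c _] := @MVT_segment R sin cos 0 x (ltW x0) (fun y _ => is_derive_sin y)
  (continuous_subspaceT (@continuous_sin R)).
rewrite sin0 !subr0 => ->; rewrite normrM ler_piMl//.
exact: cos_max.
Qed.

Lemma normr_phihat_le1 e (l : int) : `|phihat e l| <= 1.
Proof.
rewrite /phihat; case: ifPn => [_|_]; first by rewrite normr1.
have [->|x0] := eqVneq (l%:~R * e) 0; first by rewrite invr0 mulr0 normr0.
by rewrite normrM normfV ler_pdivrMr ?normr_gt0// mul1r normr_sin_le.
Qed.

Lemma phihat_abs e (l : int) : phihat e l = phihat e (absz l : int).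
Proof.
case: l => n; first by rewrite absz_nat.
rewrite NegzE abszN absz_nat /phihat oppr_eq0 /=.
by rewrite mulrNz mulNr sinN invrN mulrNN.
Qed.

(** On an interval symmetric about 0 the odd part contributes nothing; the
  average of the even part is [phihat]. *)
Lemma Rintegral_phihat e (u v : R) (n : nat) : 0 < e ->
  \int[leb]_(x in `[- e, e]) (u * cos (n%:R * x) - v * sin (n%:R * x)) =
  2 * e * phihat e n * u.
Proof.
move=> e0; have ee : - e < e by rewrite (lt_trans _ e0)// oppr_lt0.
have [->|n0] := posnP n.
  under eq_Rintegral do rewrite !mul0r cos0 sin0 mulr1 mulr0 subr0.
  rewrite Rintegral_cst//= lebesgue_measure_itv/= lte_fin ee -EFinB/= /phihat eqxx.
  by ring.
have n0' : (n%:R : R) != 0 by rewrite pnatr_eq0 -lt0n.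
rewrite Rintegral_trig// !mulrN sinN cosN /phihat -[_ == _ :> int]/(n == 0%N).
rewrite gtn_eqF// -[n%:~R]/(n%:R).
by field; rewrite n0' gt_eqF.
Qed.

(** Dominated convergence by a constant on a bounded interval. *)
Lemma Rintegral_cvg_bounded (h_ : nat -> R -> R) (h : R -> R) (p q K : R) :
  (forall n, continuous (h_ n)) -> (forall n x, `|h_ n x| <= K) ->
  (forall x, h_ n x @[n --> \oo] --> h x) ->
  \int[leb]_(x in `[p, q]) h_ n x @[n --> \oo] --> \int[leb]_(x in `[p, q]) h x.
Proof.
move=> ch hK hh.
have mh_ n : measurable_fun (`[p, q] : set (measurableTypeR R)) (h_ n).
  by apply: measurable_funTS; exact: continuous_measurable_fun.
have mh : measurable_fun (`[p, q] : set (measurableTypeR R)) h.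
  by apply: (measurable_fun_cvg mh_) => x _; exact: hh.
have hE x : (EFin \o h_^~ x) @ \oo --> (h x)%:E.
  by apply: cvg_EFin; [exact: nearW|exact: hh].
have mI : measurable (`[p, q] : set (measurableTypeR R)) by exact: measurable_itv.
have [] := @dominated_convergence _ _ _ leb _ mI
  (fun n x => (h_ n x)%:E) (fun x => (h x)%:E) (fun=> K%:E).
- by move=> n; apply/measurable_EFinP.
- exact/measurable_EFinP.
- by apply: aeW => x _; exact: hE.
- exact: (continuous_integrable p q (@cst_continuous _ _ K)).
- by apply: aeW => x n _; rewrite abse_EFin lee_fin.
move=> ih _ lim_.
apply: fine_cvg; rewrite fineK; last exact: integrable_fin_num.
exact: lim_.
Qed.

Lemma Rintegral_sum (F : nat -> R -> R) (p q : R) N : (forall n, continuous (F n)) ->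
  \int[leb]_(x in `[p, q]) (\sum_(0 <= n < N) F n x) =
  \sum_(0 <= n < N) \int[leb]_(x in `[p, q]) F n x.
Proof.
move=> cF; elim: N => [|N IH].
  under eq_Rintegral do rewrite big_geq//.
  by rewrite Rintegral_cst// mul0r big_geq.
under eq_Rintegral do rewrite big_nat_recr//=.
rewrite RintegralD//.
- by rewrite IH big_nat_recr.
- by apply: continuous_integrable; exact: continuous_sum.
- exact: (continuous_integrable p q (cF N)).
Qed.

(** On the circle of radius |z| < 1 the power series of [f] is dominated by a
  geometric series, so it may be averaged term by term, and averaging the n-th
  term multiplies it by [phihat e n]. *)
Lemma H2_coef_Dop f a e : 0 < e -> H2_coef f a ->
  H2_coef (Dop e f) (fun n => a n * (phihat e n)%:C).
Proof.
move=> e0 [sa fa]; split.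
  by apply: (square_summableMr (C := 1)) sa => n; exact: normr_phihat_le1.
move=> z z1; have [M [M0 aM]] := square_summable_bounded sa.
have [K KP] := power_series_bound M0 (introT andP (conj (normc_ge0 z) z1)).
pose c n := a n * z ^+ n.
pose P N x := \sum_(0 <= n < N) c n * expi (n%:R * - x).
have Pf x : (P N x : R[i]^o) @[N --> \oo] --> (f (z * expi (- x)) : R[i]^o).
  have zx1 : normc (z * expi (- x)) < 1.
    by rewrite normcM [normc (expi _)]normc_expi mulr1.
  rewrite (_ : (fun N => _) = series (fun n => a n * (z * expi (- x)) ^+ n : R[i]^o)).
    exact: fa zx1.
  apply/funext => N; apply: eq_bigr => n _.
  by rewrite /c expi_nat exprMn mulrA.
have PK N x : normc (P N x) <= K.
  apply: le_trans (KP N); apply: (le_trans (normc_sum _ _ _)).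
  apply: ler_sum => n _.
  rewrite normcM [normc (expi _)]normc_expi mulr1 /c normcM normcX.
  by rewrite ler_wpM2r// exprn_ge0// normc_ge0.
(* To be used with the real and the imaginary part for [p]; [u n] and [v n] are
   then the coordinates of [p (c n * expi (- n x))] on [cos (n x)] and
   [- sin (n x)]. *)
have part (p : R[i] -> R) (u v : nat -> R) :
    (forall x y, p (x + y) = p x + p y) -> p 0 = 0 -> (forall x, `|p x| <= normc x) ->
    (forall x, p (P N x) @[N --> \oo] --> p (f (z * expi (- x)))) ->
    (forall n x, p (c n * expi (n%:R * - x)) = u n * cos (n%:R * x) - v n * sin (n%:R * x)) ->
    \sum_(0 <= n < N) phihat e n * u n @[N --> \oo] -->
      (2 * e)^-1 * \int[leb]_(x in `[- e, e]) p (f (z * expi (- x))).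
  move=> pD p0 pn pf puv.
  have pP N x : p (P N x) = \sum_(0 <= n < N) (u n * cos (n%:R * x) - v n * sin (n%:R * x)).
    by rewrite /P (big_morph p pD p0); apply: eq_bigr => n _; exact: puv.
  have cont N : continuous (fun x => p (P N x)).
    rewrite [X in continuous X](_ : _ = fun x : R => \sum_(0 <= n < N)
        (u n * cos (n%:R * x) - v n * sin (n%:R * x))).
      by apply: continuous_sum => n; exact: continuous_mul_cos.
    by apply/funext => x; exact: pP.
  have intE N : \int[leb]_(x in `[- e, e]) p (P N x) =
      2 * e * \sum_(0 <= n < N) phihat e n * u n.
    under eq_Rintegral do rewrite pP.
    rewrite Rintegral_sum; last by move=> n; exact: continuous_mul_cos.
    by rewrite mulr_sumr; apply: eq_bigr => n _; rewrite Rintegral_phihat// mulrA.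
  have e2 : 2 * e != 0 by rewrite mulf_neq0// gt_eqF.
  rewrite (_ : (fun N => _) = fun N => (2 * e)^-1 * \int[leb]_(x in `[- e, e]) p (P N x)).
    apply: cvgM; first exact: cvg_cst.
    exact: (@Rintegral_cvg_bounded (fun N x => p (P N x)) _ (- e) e K cont
      (fun N x => le_trans (pn _) (PK N x)) pf).
  by apply/funext => N; rewrite intE mulKf.
have prodE n : a n * (phihat e n)%:C * z ^+ n =
    (phihat e n * complex.Re (c n)) +i* (phihat e n * complex.Im (c n)).
  rewrite /c mulrAC; case: (a n * z ^+ n) => x y; apply/eqP.
  by rewrite eq_complex/= !mulr0 subr0 add0r mulrC eqxx mulrC/=; apply/eqP; ring.
have DE : Dop e f z = ((2 * e)^-1 * \int[leb]_(x in `[- e, e]) complex.Re (f (z * expi (- x))))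
   +i* ((2 * e)^-1 * \int[leb]_(x in `[- e, e]) complex.Im (f (z * expi (- x)))).
  by apply/eqP; rewrite /Dop eq_complex/= !mul0r subr0 addr0 !eqxx.
rewrite DE; apply/cvgc_ReImP; split => /=.
- rewrite (_ : (fun N => _) = fun N => \sum_(0 <= n < N) phihat e n * complex.Re (c n)).
    apply: (part (@complex.Re R) (fun n => complex.Re (c n)) (fun n => - complex.Im (c n))).
    + exact: ReD.
    + by [].
    + exact: normc_Re.
    + by move=> x; have [] := (cvgc_ReImP _ _).1 (Pf x).
    + by move=> n x; rewrite Re_mul_expi mulrN cosN sinN mulrN mulNr.
  by apply/funext => N; rewrite Re_sum; apply: eq_bigr => n _; rewrite prodE.
- rewrite (_ : (fun N => _) = fun N => \sum_(0 <= n < N) phihat e n * complex.Im (c n)).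
    apply: (part (@complex.Im R) (fun n => complex.Im (c n)) (fun n => complex.Re (c n))).
    + exact: ImD.
    + by [].
    + exact: normc_Im.
    + by move=> x; have [] := (cvgc_ReImP _ _).1 (Pf x).
    + by move=> n x; rewrite Im_mul_expi mulrN cosN sinN mulrN addrC.
  by apply/funext => N; rewrite Im_sum; apply: eq_bigr => n _; rewrite prodE.
Qed.

End Averages.

(** * Series of multipliers *)

Section Multipliers.
Variable R : realType.
Local Open Scope complex_scope.
Implicit Types (f : R[i] -> R[i]) (a : nat -> R[i]) (eps : nat -> R).

Definition phihat_diff eps (k l : nat) : R :=
  phihat (eps k.+1) l - phihat (eps k) l.

Lemma H2_coef_Dop_diff f a eps k : (forall k, 0 < eps k) -> H2_coef f a ->
  H2_coef (fun z => Dop (eps k.+1) f z - Dop (eps k) f z)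
          (fun n => a n * (phihat_diff eps k n)%:C).
Proof.
move=> e0 fa.
have := H2_coefB (H2_coef_Dop (e0 k.+1) fa) (H2_coef_Dop (e0 k) fa).
by under [X in H2_coef _ X -> _]funext do rewrite -mulrBr -rmorphB.
Qed.

Lemma normr_phihat_diff_le2 eps k l : `|phihat_diff eps k l| <= 2.
Proof.
by rewrite (le_trans (ler_normB _ _))// (_ : 2 = 1 + 1)// lerD// normr_phihat_le1.
Qed.

(** Both directions pass through partial sums; negative frequencies give the
  same sums as their opposites. *)
Lemma bounded_phihat_diffP eps :
  (exists C, forall l n, \sum_(0 <= k < n) `|phihat_diff eps k l| <= C) <->
  (exists C : R,
     (ereal_sup [set \sum_(0 <= k <oo)
                       (`|phihat (eps k.+1) l - phihat (eps k) l|)%:E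
                | l in [set: int]] <= C%:E)%E).
Proof.
split=> -[C CP]; exists C.
  apply: ge_ereal_sup => _ [l _ <-]; apply: lime_le.
    by apply: is_cvg_nneseries => k _ _; rewrite lee_fin.
  near=> n; rewrite sumEFin lee_fin; apply: le_trans (CP (absz l) n).
  by apply: ler_sum => k _; rewrite !(phihat_abs _ l).
move=> l n; rewrite -lee_fin -sumEFin; apply: le_trans CP.
apply: (@le_trans _ _ (\sum_(0 <= k <oo) (`|phihat_diff eps k l|)%:E)%E).
  by apply: nneseries_lim_ge => k _ _; rewrite lee_fin.
by apply: ereal_sup_ubound; exists (l : int).
Unshelve. all: by end_near. Qed.

Lemma normc_le_sqrt_sqr_sum a n : square_summable a ->
  normc (a n) <= Num.sqrt (sqr_sum a).
Proof.
move=> sa; rewrite -[leLHS]ger0_norm ?normc_ge0// -sqrtr_sqr ler_wsqrtr//.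
apply: le_trans (ge0_series_le_lim n.+1 (sqr_normc_ge0 a) sa).
by rewrite /series/= big_nat_recr//= lerDr sumr_ge0// => k _; exact: sqr_ge0.
Qed.

Lemma H2_coef_partial_sum (F : nat -> R[i] -> R[i]) (d : nat -> nat -> R) a g b n :
  (forall k, H2_coef (F k) (fun l => a l * (d k l)%:C)) -> H2_coef g b ->
  H2_coef (fun z => \sum_(0 <= k < n) F k z - g z)
          (fun l => a l * (\sum_(0 <= k < n) d k l)%:C - b l).
Proof.
move=> Fa gb; have := H2_coefB (H2_coef_sum n Fa) gb.
by under [X in H2_coef _ X -> _]funext do rewrite -mulr_sumr -rmorph_sum.
Qed.

(** The sum is the function whose coefficients are multiplied by T(l), the sum
  over [k] of [d k l]. The distance from it to a partial sum tends to 0 by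
  dominated convergence, the dominating sequence being (2 C)^2 |a l|^2. *)
Lemma H2_cvg_series_multiplier (F : nat -> R[i] -> R[i]) (d : nat -> nat -> R) a C :
  square_summable a -> (forall k, H2_coef (F k) (fun l => a l * (d k l)%:C)) ->
  (forall l n, \sum_(0 <= k < n) `|d k l| <= C) -> H2_cvg_series F.
Proof.
move=> sa Fa dC; split; first by move=> k; exists (fun l => a l * (d k l)%:C).
pose D n l := \sum_(0 <= k < n) d k l.
pose T l := limn (series (d ^~ l)).
have DT l : D n l @[n --> \oo] --> T l.
  by apply: normed_cvg; apply: (bounded_cvg_series (C := C)) => n;
    [exact: normr_ge0|exact: dC].
have DC n l : `|D n l| <= C by exact: le_trans (ler_norm_sum _ _ _) (dC l n).
have TC l : `|T l| <= C.
  have h : `|D n l| @[n --> \oo] --> `|T l| by apply: cvg_norm; exact: DT.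
  rewrite -(cvg_lim _ h)//; apply: limr_le; last by near=> n; exact: DC.
  by apply/cvg_ex; eexists; exact: h.
have [g gb] := ex_H2_coef (square_summableMr TC sa).
exists g; split; first by eexists; exact: gb.
pose c n l := a l * (D n l - T l)%:C.
have Sc n : H2_coef (fun z => \sum_(0 <= k < n) F k z - g z) (c n).
  have := H2_coef_partial_sum n Fa gb.
  by under [X in H2_coef _ X -> _]funext do rewrite -mulrBr -rmorphB.
under eq_fun do rewrite (H2normE (Sc _)).
apply: cvg_EFin; first exact: nearW.
rewrite -[X in _ --> X]sqrtr0; apply: cvg_sqrt.
apply/cvgrPdist_le => e e0.
have C0 : 0 <= C by exact: le_trans (TC 0%N).
have sqb n l : 0 <= (D n l - T l) ^+ 2 <= (C + C) ^+ 2.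
  rewrite sqr_ge0/= -real_normK ?num_real// lerXn2r ?nnegrE ?addr_ge0//.
  by rewrite (le_trans (ler_normB _ _))// lerD.
have sq0 l : (D n l - T l) ^+ 2 @[n --> \oo] --> (0 : R).
  have h : D n l - T l @[n --> \oo] --> T l - T l.
    by apply: cvgB; [exact: DT|exact: cvg_cst].
  by have h2 := cvgM h h; rewrite subrr mulr0 in h2; exact: h2.
have := @tannery _ (fun l => normc (a l) ^+ 2) (fun n l => (D n l - T l) ^+ 2) _
  (sqr_normc_ge0 a) sa sqb sq0 e e0.
apply: filterS => n small.
rewrite sub0r normrN ger0_norm; last first.
  by have [sc _] := Sc n; have := sqr_tail_ge0 0 sc; rewrite /sqr_tail big_geq// subr0.
apply: limr_le; first by have [] := Sc n.
near=> L; apply: le_trans (small L); apply: ler_sum => l _.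
by rewrite normcM exprMn normc_real real_normK ?num_real.
Unshelve. all: by end_near. Qed.

(** A coefficient is at most the norm, so convergence in norm makes the partial
  sums of each coefficient Cauchy at a rate that does not depend on [l]. *)
Lemma H2_cvg_series_coef_cauchy (F : nat -> R[i] -> R[i]) (d : nat -> nat -> R) a :
  (forall k, H2_coef (F k) (fun l => a l * (d k l)%:C)) -> H2_cvg_series F ->
  exists N, forall l n p, (N <= n <= p)%N ->
    normc (a l * (\sum_(n <= k < p) d k l)%:C) < 1.
Proof.
move=> Fa [_ [g [[b gb] g0]]].
pose c n l := a l * (\sum_(0 <= k < n) d k l)%:C - b l.
have Sc n : H2_coef (fun z => \sum_(0 <= k < n) F k z - g z) (c n).
  exact: H2_coef_partial_sum.
have h2 : (0 < 2^-1 :> R) by rewrite invr_gt0.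
have /fine_cvgP[_ /cvgrPdist_lt /(_ _ h2) [N _ NP]] := g0.
have small n l : (N <= n)%N -> normc (c n l) < 2^-1.
  move=> /NP; rewrite /= (H2normE (Sc n))/= sub0r normrN ger0_norm ?sqrtr_ge0//.
  by apply: le_lt_trans; apply: normc_le_sqrt_sqr_sum; have [] := Sc n.
exists N => l n p /andP[Nn np].
have -> : a l * (\sum_(n <= k < p) d k l)%:C = c p l - c n l.
  rewrite /c (big_cat_nat (n := n) (m := 0) (p := p))//= rmorphD mulrDr; ring.
apply: (le_lt_trans (normcB _ _)); rewrite [ltRHS](splitr 1) !div1r.
by apply: ltrD; apply: small => //; exact: leq_trans np.
Qed.

End Multipliers.

Unset Implicit Arguments.

(* [eps k] is the term of index k + 1 of the sequence. *)
Theorem theorem5p2 (R : realType) (eps : nat -> R)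
    (eps_gt0 : forall k, 0 < eps k) (eps_cvg0 : eps @ \oo --> (0 : R)) :
  (forall f : R[i] -> R[i], H2 f ->
     H2_unconditionally_cvg_series
       (fun k z => Dop (eps k.+1) f z - Dop (eps k) f z))
  <->
  (exists C : R,
     (ereal_sup [set \sum_(0 <= k <oo)
                       (`|phihat (eps k.+1) l - phihat (eps k) l|)%:E
                | l in [set: int]] <= C%:E)%E).
Proof.
rewrite -bounded_phihat_diffP; split=> [unc|[C dC] f [a fa] s bs].
  apply: (bounded_sums_of_uncond (normr_phihat_diff_le2 eps)) => a a0 sa s bs.
  have saC : square_summable (fun l => (a l)%:C%C).
    rewrite /square_summable (_ : (fun n => _) = fun n => a n ^+ 2)//.
    by apply/funext => n; rewrite normc_real real_normK ?num_real.
  have [f fa] := ex_H2_coef saC.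
  have [] := H2_cvg_series_coef_cauchy
    (fun k => H2_coef_Dop_diff (s k) eps_gt0 fa) (unc f (ex_intro _ _ fa) s bs).
  move=> N NP; exists N => l n p /NP -/(_ l).
  by rewrite -rmorphM normc_real.
apply: (H2_cvg_series_multiplier (C := C) (proj1 fa)
  (fun k => H2_coef_Dop_diff (s k) eps_gt0 fa)) => l n.
have [N] := le_sum_rearrangement n (bij_inj bs)
  (fun k => normr_ge0 (phihat_diff eps k l)).
by move=> h; exact: le_trans h (dC l N).
Qed.
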